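(* If $(X,x)$ is a non-Gorenstein (reduced) curve singularity, then $\delta_{\mathrm{deg}}(x)>0$.
   Context: The base field is algebraically closed of characteristic zero. Let $\nu\colon(\widetilde{X},\nu^{-1}(x))\to(X,x)$ be the normalization of a reduced curve singularity and $\mathfrak{c}_x\subset\mathcal{O}_{X,x}$ the conductor ideal $\mathrm{Ann}(\nu_*\mathcal{O}_{\widetilde{X}}/\mathcal{O}_X)_x$. Let $V$ be the vector space of allowed principal parts of meromorphic differentials on $\widetilde{X}$ at the points above $x$ (poles bounded by a divisor supported on $\nu^{-1}(x)$ with multiplicities large enough to allow all principal parts potentially obstructing descent), and $W\subset V$ the subspace of principal parts annihilated by $\mathfrak{c}_x$. The conductor constraints are the linear conditions cutting out $W$ in $V$; the actual linear constraints are the linear conditions cutting out the principal parts in $V$ that descend to the dualizing module $\omega_{X,x}$. The local degeneracy contribution is \[ \delta_{\mathrm{deg}}(x)=(\text{number of actual linear constraints})-(\text{number of conductor constraints}). \] $(X,x)$ is Gorenstein if $\omega_{X,x}$ is locally free of rank one. *)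

(* Defs.v *)
From HB Require Import structures.
From mathcomp Require Import all_boot all_algebra.
From mathcomp Require Import boolp classical_sets.

Set Implicit Arguments.
Unset Strict Implicit.
Unset Printing Implicit Defensive.

Import GRing.Theory.
Local Open Scope ring_scope.

(* Setting: everything is expressed on the level of Zariski-local rings.
     A = O_{X,x},    B = (nu_* O_{X~})_x, a semilocal ring,
     K = the common total ring of fractions of A and B,
     M = Omega_{K/k}, the meromorphic differentials on X~ near nu^{-1}(x).
   Ideals are Prop-valued predicates. *)

Section Ideals.
Variable R : comNzRingType.

Definition is_ideal (I : R -> Prop) : Prop :=
  [/\ I 0, (forall x y, I x -> I y -> I (x + y)) &
      (forall r x, I x -> I (r * x))].

Definition is_prime_ideal (I : R -> Prop) : Prop :=
  [/\ is_ideal I, ~ I 1 & (forall x y, I (x * y) -> I x \/ I y)].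

Definition strict_sub (I J : R -> Prop) : Prop :=
  (forall x, I x -> J x) /\ (exists2 x, J x & ~ I x).

Definition has_prime_chain (n : nat) : Prop :=
  exists q : nat -> R -> Prop,
    (forall i, (i <= n)%N -> is_prime_ideal (q i)) /\
    (forall i, (i < n)%N -> strict_sub (q i) (q i.+1)).

Definition krull_dim (n : nat) : Prop :=
  has_prime_chain n /\ ~ has_prime_chain n.+1.

Definition is_reduced : Prop := forall (x : R) n, x ^+ n = 0 -> x = 0.

Definition nonzerodivisor (s : R) : Prop := forall x, s * x = 0 -> x = 0.

End Ideals.

Section LocalRings.
Variables (k : closedFieldType) (A : comUnitAlgType k).

Inductive generated_subalgebra (g : seq A) : A -> Prop :=
| Gen_scalar c : generated_subalgebra g (c%:A)
| Gen_elt x : x \in g -> generated_subalgebra g x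
| Gen_add x y : generated_subalgebra g x -> generated_subalgebra g y ->
    generated_subalgebra g (x + y)
| Gen_mul x y : generated_subalgebra g x -> generated_subalgebra g y ->
    generated_subalgebra g (x * y).

Definition essentially_of_finite_type : Prop :=
  exists g : seq A, forall a, exists u v,
    [/\ generated_subalgebra g u, generated_subalgebra g v,
        v \is a GRing.unit & a = u / v].

Definition is_local : Prop :=
  forall a : A, a \is a GRing.unit \/ 1 - a \is a GRing.unit.

Definition max_ideal (a : A) : Prop := a \isn't a GRing.unit.

(* A is the local ring of a reduced algebraic curve over k at a closed point.
   The last clause says that the residue field is k; without it, A could be
   the local ring of a higher-dimensional variety at a non-closed point. *)
Record reduced_curve_local_ring : Prop := ReducedCurveLocalRing {
  rclr_eft : essentially_of_finite_type;
  rclr_local : is_local;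
  rclr_reduced : is_reduced A;
  rclr_dim1 : krull_dim A 1;
  rclr_closed : forall a : A, exists c : k, max_ideal (a - c%:A)
}.

End LocalRings.

Section Derivations.
Variables (k : closedFieldType) (K : comUnitAlgType k).

Definition is_derivation (N : lmodType K) (D : K -> N) : Prop :=
  [/\ (forall x y, D (x + y) = D x + D y),
      (forall (c : k) x, D (c *: x) = c%:A *: D x) &
      (forall x y, D (x * y) = x *: D y + y *: D x)].

Definition is_kaehler (M : lmodType K) (d : K -> M) : Prop :=
  is_derivation d /\
  forall (N : lmodType K) (D : K -> N), is_derivation D ->
    (exists phi : {linear M -> N}, forall x, phi (d x) = D x) /\
    (forall phi psi : {linear M -> N},
       (forall x, phi (d x) = D x) -> (forall x, psi (d x) = D x) ->
       forall m, phi m = psi m).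

End Derivations.

Section LinearConstraints.
Variables (k : closedFieldType) (V : vectType k).

Definition cut_out_by (S : V -> Prop) (n : nat) : Prop :=
  exists phi : n.-tuple 'Hom(V, k^o),
    free phi /\ forall v, S v <-> forall i, tnth phi i v = 0.

(* The number of independent linear conditions cutting out S in V, i.e. its
   codimension; the value 0 is junk if S is not a linear subspace. *)
Definition num_constraints (S : V -> Prop) : nat :=
  xget 0%N [set n | cut_out_by S n].

End LinearConstraints.

Section Singularity.
Variables (k : closedFieldType) (A : comUnitAlgType k) (B : comAlgType k).
Variables (K : comUnitAlgType k).
Variables (nu : {lrmorphism A -> B}) (iB : {lrmorphism B -> K}).

Definition iA (a : A) : K := iB (nu a).

Definition is_total_fraction_ring : Prop :=
  [/\ injective iA,
      (forall s, nonzerodivisor s -> iA s \is a GRing.unit) &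
      (forall z, exists a s, nonzerodivisor s /\ z = iA a / iA s)].

Record is_normalization : Prop := IsNormalization {
  nrm_fractions : is_total_fraction_ring;
  nrm_inj : injective iB;
  nrm_closure : forall z : K, integralOver iA z <-> exists b, z = iB b
}.

(* Ann_A(B / A) *)
Definition conductor (f : A) : Prop := forall b : B, exists a : A, nu a = nu f * b.

Variables (M : lmodType K) (d : K -> M).
Variables (P : finType) (pt : P -> B -> Prop).

(* P indexes, without repetition, the primes of B lying over the maximal ideal
   of A, i.e. the points of nu^{-1}(x). *)
Record is_fiber : Prop := IsFiber {
  fib_prime : forall p, is_prime_ideal (pt p);
  fib_over : forall p a, pt p (nu a) <-> max_ideal a;
  fib_all : forall q : B -> Prop, is_prime_ideal q ->
    (forall a, q (nu a) <-> max_ideal a) ->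
    exists p, forall b, pt p b <-> q b;
  fib_inj : forall p p', (forall b, pt p b <-> pt p' b) -> p = p'
}.

(* u generates the maximal ideal of the local ring B_p. The requirement that u
   be invertible in K (which can always be met) is there because K is only a
   product of fields, and u^-1 is needed as an element of K. *)
Definition uniformizer (p : P) (u : B) : Prop :=
  [/\ pt p u, iB u \is a GRing.unit &
      forall b, pt p b -> exists s c, ~ pt p s /\ s * b = c * u].

(* The image of Omega_B in Omega_K. *)
Definition regular_diff (eta : M) : Prop :=
  exists s : seq (B * B), eta = \sum_(bc <- s) iB bc.1 *: d (iB bc.2).

Definition regular_at (p : P) (eta : M) : Prop :=
  exists s, ~ pt p s /\ regular_diff (iB s *: eta).

Variable t : P -> B.

(* sum_{j = 1}^n a_{j-1} t_p^{-j} dt_p *)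
Definition polar_part (p : P) (n : nat) (a : 'I_n -> k) : M :=
  \sum_(j < n) ((a j)%:A / iB (t p) ^+ j.+1) *: d (iB (t p)).

(* The residue is the coefficient of dt_p / t_p in the Laurent tail. *)
Definition is_residue (p : P) (eta : M) (c : k) : Prop :=
  exists n (a : 'I_n.+1 -> k),
    regular_at p (eta - polar_part p a) /\ a ord0 = c.

Definition residue (p : P) (eta : M) : k := xget 0 [set c | is_residue p eta c].

(* Rosenlicht's description of the dualizing module omega_{X,x}. *)
Definition dualizing (eta : M) : Prop :=
  forall f : A, \sum_p residue p (iA f *: eta) = 0.

(* As A is local, locally free means free. *)
Definition gorenstein : Prop :=
  exists2 eta0, dualizing eta0 &
    forall eta, dualizing eta -> exists! a : A, eta = iA a *: eta0.

Variable D : P -> nat.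

(* c_x O_{X~,p} contains m_p^{D p} for all p, i.e. the divisor sum_p D(p) p is
   at least the conductor divisor. *)
Definition dominates_conductor : Prop :=
  forall p, exists s f, [/\ ~ pt p s, conductor f & nu f = s * t p ^+ D p].

(* Principal parts with poles bounded by D, given by their Laurent tails:
   the coordinate (p, j) is the coefficient of t_p^{-(j+1)} dt_p. *)
Definition principal_parts := {ffun {p : P & 'I_(D p)} -> k^o}.

Definition has_principal_part (eta : M) (v : principal_parts) : Prop :=
  forall p, regular_at p
    (eta - polar_part p (fun j : 'I_(D p) => v (Tagged (fun q => 'I_(D q)) j))).

(* Multiplication by f acts on principal parts through representatives, and
   a principal part is zero iff its representatives are regular. *)
Definition conductor_annihilated (v : principal_parts) : Prop :=
  exists2 eta, has_principal_part eta v &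
    forall f, conductor f -> forall p, regular_at p (iA f *: eta).

Definition descends (v : principal_parts) : Prop :=
  exists2 eta, has_principal_part eta v & dualizing eta.

Definition delta_deg : int :=
  (num_constraints descends)%:Z - (num_constraints conductor_annihilated)%:Z.

End Singularity.

(* Main.v *)
Require Import Defs.
From HB Require Import structures.
From mathcomp Require Import all_boot all_algebra.
From mathcomp Require Import boolp classical_sets ring.

(* Completing at a point p over x gives a Taylor map T_p from B to k[[X]]; it
   extends to K, and d/dX then yields, by the universal property of Kaehler
   differentials, a map from M to k((X)) that sends regular differentials into
   k[[X]] and dt_p to 1. This makes residues well defined and additive.
     If eta descends and f is in the conductor, then f b is in A for every b in
   B, so the residues of b f eta sum to 0; choosing b with prescribed expansions
   at the points over x shows that f eta is regular. Hence the descending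
   principal parts lie in W.
     If A <> B, the conductor lies in the maximal ideal, so it annihilates a
   simple pole at a single point over x. Such a principal part lies in W, and
   its residues do not sum to 0, so it does not descend. If A = B, Nakayama's
   lemma shows that the regular differentials are freely generated by dt, and
   they are the dualizing module, so (X,x) is Gorenstein. *)

(** Constraint counts are codimensions in the finite-dimensional space of principal parts, so the
    local contribution is the dimension of W minus that of the space of descending parts, and a
    strict inclusion is what has to be shown. The main obstacle is the kernel of T_p. The maximal
    ideal of the local ring at p is principal, but its powers may intersect nontrivially, and T_p
    extends to K only if no denominator expands to 0. Here dimension one, reducedness and a
    conductor element with nonzero expansion enter: they show that an element with zero expansion
    already vanishes in the local ring at p. The second obstacle is that residues are selected by
    choice, with 0 as the default. Each residue computation therefore carries a bound on the length
    of a Laurent tail. Finally, principal parts are realized by elements of M, which see all points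
    over x at once; a separating function, close to 1 at one point and to 0 at the others, isolates
    a single point. *)

Set Implicit Arguments.
Unset Strict Implicit.
Unset Printing Implicit Defensive.

Import GRing.Theory Num.Theory.
Local Open Scope ring_scope.

(** * Prime ideals *)


Section PrimeIdeals.
Variable R : comNzRingType.
Implicit Types (S q : R -> Prop) (x y : R).

(** Zorn's lemma on the ideals disjoint from [S]. If [x] and [y] lie outside a maximal one,
    enlarging it by either meets [S]; the product of the two meeting points shows that [x * y] lies
    outside too. The last clause records maximality; for [S] reduced to 1 it says that [q] is a
    maximal ideal. *)
Lemma prime_avoiding S : S 1 -> (forall x y, S x -> S y -> S (x * y)) -> ~ S 0 ->
  exists q, [/\ is_prime_ideal q, (forall x, q x -> ~ S x) &
    (forall x, ~ q x -> exists r s, S s /\ q (s - r * x))].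
Proof.
move=> S1 SM S0.
(* Containing 0 is not demanded, because the union of the empty chain has to be good; it follows
   afterwards by comparing a maximal [X] with the zero ideal. *)
pose good (X : set R) := [/\ (forall x y, X x -> X y -> X (x + y)),
  (forall r x, X x -> X (r * x)) & (forall x, X x -> ~ S x)].
have [F Fgood Ftot|X [[XD XM XS] Xmax]] := @Zorn_bigcup R good.
  split=> [x y [U FU Ux] [V FV Vy]|r x [U FU Ux]|x [U FU Ux]].
  - have [UV|VU] := Ftot _ _ FU FV.
      by exists V => //; have [VD _ _] := Fgood _ FV; apply: VD => //; apply: UV.
    by exists U => //; have [UD _ _] := Fgood _ FU; apply: UD => //; apply: VU.
  - by exists U => //; have [_ UM _] := Fgood _ FU; apply: UM.
  - by have [_ _ US] := Fgood _ FU; apply: US.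
have X0 : X 0.
  apply: contrapT => NX0; apply: (Xmax (fun x => x = 0)) => //.
    split=> [x Xx|sub]; last by apply: NX0; apply: sub.
    by case: NX0; rewrite -(mul0r x); apply: XM.
  by split=> [x y -> ->|r x ->|x ->] //=; rewrite ?addr0 ?mulr0.
have Xcomax x : ~ X x -> exists r s, S s /\ X (s - r * x).
  move=> NXx; apply: contrapT => Nmeet.
  apply: (Xmax (fun y => exists r, X (y - r * x))) => //.
    split=> [y Xy|sub]; first by exists 0; rewrite mul0r subr0.
    by apply: NXx; apply: sub; exists 1; rewrite mul1r subrr.
  split=> [y z [r Xy] [s Xz]|r y [s Xy]|y [r Xy] Sy]; last by apply: Nmeet; exists r, y.
  - by exists (r + s); rewrite mulrDl opprD addrACA; apply: XD.
  - by exists (r * s); rewrite -mulrA -mulrBr; apply: XM.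
exists X; split=> //; split=> // [X1|x y Xxy]; first exact: XS X1 S1.
apply: contrapT => /not_orP [Nx Ny].
have [r [s [Ss Xs]]] := Xcomax _ Nx; have [r' [s' [Ss' Xs']]] := Xcomax _ Ny.
apply: (XS (s * s')); last exact: SM.
have -> : s * s' = s' * (s - r * x) + (r * x) * (s' - r' * y) + (r * r') * (x * y).
  by ring.
by apply: (XD); [apply: XD|]; apply: XM.
Qed.

Lemma maximal_ideal_exists : exists q : R -> Prop,
  is_prime_ideal q /\ forall x, ~ q x -> exists r, q (1 - r * x).
Proof.
have [||/= q [qprime _ qmax]] := @prime_avoiding (fun x => x = 1) erefl.
- by move=> x y -> ->; rewrite mulr1.
- by move/eqP; rewrite eq_sym oner_eq0.
exists q; split=> // x /qmax [r [s [-> qs]]]; by exists r.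
Qed.

(* The localization of a reduced ring at a minimal prime is a field. *)
Lemma minimal_prime_killed q x : is_reduced R -> is_prime_ideal q ->
  (forall q', is_prime_ideal q' -> ~ strict_sub q' q) ->
  q x -> exists2 y, ~ q y & x * y = 0.
Proof.
move=> red [[q0 qD qM] q1 qP] qmin qx.
(* A prime avoiding [S] would lie strictly below [q], so 0 is in [S]: some [x ^+ n * y] vanishes,
   and reducedness lowers the exponent to 1. *)
pose S z := exists n y, ~ q y /\ z = x ^+ n * y.
have qMN y z : ~ q y -> ~ q z -> ~ q (y * z) by move=> Ny Nz /qP [].
have [[n [y [Ny /esym xy0]]]|S0] := pselect (S 0).
  exists y => //; apply: (red _ n.+1).
  have -> : (x * y) ^+ n.+1 = x * y ^+ n * (x ^+ n * y).
    by rewrite exprMn [x ^+ n.+1]exprS exprSr mulrACA.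
  by rewrite xy0 mulr0.
have [||q' [q'prime q'S _]] := @prime_avoiding S _ _ S0.
- by exists 0, 1; split=> //; rewrite mulr1.
- move=> _ _ [n [y [Ny ->]]] [n' [y' [Ny' ->]]]; exists (n + n')%N, (y * y').
  by split; [exact: qMN|rewrite exprD mulrACA].
case: (qmin _ q'prime); split=> [y q'y|].
  by apply: contrapT => Ny; apply: (q'S _ q'y); exists 0, y; rewrite mul1r.
by exists x => // q'x; apply: (q'S _ q'x); exists 1, 1; rewrite mulr1.
Qed.
End PrimeIdeals.

(** * Formal power series and Laurent residues *)


Definition power_series (k : fieldType) : Type := nat -> k.

Section PowerSeries.
Variable k : fieldType.
Local Notation ps := (power_series k).
Implicit Types (f g h : ps) (n m : nat).

HB.instance Definition _ := gen_eqMixin ps.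
HB.instance Definition _ := gen_choiceMixin ps.

Definition ps_add f g : ps := fun n => f n + g n.
Definition ps_opp f : ps := fun n => - f n.
Definition ps_const (c : k) : ps := fun n => if n is 0 then c else 0.
Definition ps_mul f g : ps := fun n => \sum_(i < n.+1) f i * g (n - i)%N.

Lemma ps_addA : associative ps_add.
Proof. by move=> f g h; apply/funext => n; apply: addrA. Qed.
Lemma ps_addC : commutative ps_add.
Proof. by move=> f g; apply/funext => n; apply: addrC. Qed.
Lemma ps_add0 : left_id (fun _ => 0) ps_add.
Proof. by move=> f; apply/funext => n; apply: add0r. Qed.
Lemma ps_addN : left_inverse (fun _ => 0) ps_opp ps_add.
Proof. by move=> f; apply/funext => n; apply: addNr. Qed.

HB.instance Definition _ := GRing.isZmodule.Build ps ps_addA ps_addC ps_add0 ps_addN.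

(* Ring identities for series reduce to polynomial ones on truncations. *)
Definition truncation n f : {poly k} := \poly_(i < n) f i.

Lemma coef_truncation n f i : (i < n)%N -> (truncation n f)`_i = f i.
Proof. by move=> lt_in; rewrite coef_poly lt_in. Qed.

Lemma ps_mul_coef (p q : {poly k}) f g n :
  (forall i, (i <= n)%N -> p`_i = f i) -> (forall i, (i <= n)%N -> q`_i = g i) ->
  (p * q)`_n = ps_mul f g n.
Proof.
move=> pf qg; rewrite coefM; apply: eq_bigr => i _.
by rewrite pf ?qg ?leq_subr // -ltnS.
Qed.

Lemma ps_mulE f g n i : (i < n)%N ->
  ps_mul f g i = (truncation n f * truncation n g)`_i.
Proof.
by move=> lt_in; rewrite (@ps_mul_coef _ _ f g) // => j le_ji;
   rewrite coef_truncation // (leq_ltn_trans le_ji).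
Qed.

Lemma ps_mulA : associative ps_mul.
Proof.
move=> f g h; apply/funext => n.
pose T := truncation n.+1.
rewrite -(@ps_mul_coef (T f) (T g * T h)) => [|i le_in|i le_in]; last 2 first.
- by rewrite coef_truncation.
- by rewrite (@ps_mulE g h n.+1).
rewrite mulrA; apply: ps_mul_coef => i le_in; last by rewrite coef_truncation.
by rewrite (@ps_mulE f g n.+1).
Qed.

Lemma ps_mulC : commutative ps_mul.
Proof. by move=> f g; apply/funext => n; rewrite !(@ps_mulE _ _ n.+1) // mulrC. Qed.

Lemma ps_mul1 : left_id (ps_const 1) ps_mul.
Proof.
move=> f; apply/funext => n; rewrite /ps_mul big_ord_recl mul1r subn0.
by rewrite big1 ?addr0 // => i _; rewrite mul0r.
Qed.

Lemma ps_mulDl : left_distributive ps_mul ps_add.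
Proof.
move=> f g h; apply/funext => n; rewrite /ps_mul /ps_add -big_split /=.
by apply: eq_bigr => i _; rewrite mulrDl.
Qed.

Lemma ps_oner_neq0 : ps_const 1 != 0 :> ps.
Proof. by apply/eqP => /(congr1 (@^~ 0%N)) /eqP; rewrite /= oner_eq0. Qed.

HB.instance Definition _ := GRing.Zmodule_isComNzRing.Build ps
  ps_mulA ps_mulC ps_mul1 ps_mulDl ps_oner_neq0.

Lemma psD f g n : (f + g) n = f n + g n. Proof. by []. Qed.
Lemma psN f n : (- f) n = - f n. Proof. by []. Qed.
Lemma ps0 n : (0 : ps) n = 0. Proof. by []. Qed.
Lemma ps1 : 1 = ps_const 1. Proof. by []. Qed.
Lemma psM f g n : (f * g) n = ps_mul f g n. Proof. by []. Qed.
Lemma psM0 f g : (f * g) 0%N = f 0%N * g 0%N.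
Proof. by rewrite psM /ps_mul big_ord1. Qed.
Lemma psX0 f n : (f ^+ n) 0%N = f 0%N ^+ n.
Proof. by elim: n => [|n IH]; rewrite ?expr0 // !exprS psM0 IH. Qed.

Lemma ps_constM c f n : (ps_const c * f) n = c * f n.
Proof.
rewrite psM /ps_mul big_ord_recl subn0 big1 ?addr0 // => i _.
by rewrite mul0r.
Qed.

Definition psX : ps := fun n => (n == 1)%:R.

Lemma psXM f n : (psX * f) n = if n is m.+1 then f m else 0.
Proof.
rewrite psM /ps_mul big_ord_recl mul0r add0r; case: n => [|n].
  by rewrite big_ord0.
rewrite big_ord_recl mul1r /= subn1 big1 ?addr0 // => i _.
by rewrite mul0r.
Qed.

Lemma psXnM m f n : (psX ^+ m * f) (m + n)%N = f n.
Proof. by elim: m => [|m IH]; rewrite ?expr0 ?mul1r // exprS -mulrA addSn psXM. Qed.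

Lemma psXnM_low m f n : (n < m)%N -> (psX ^+ m * f) n = 0.
Proof.
elim: m n => // m IH [|n] lt_nm; rewrite exprS -mulrA psXM //.
exact: IH.
Qed.

Lemma psXnE m n : (psX ^+ m) n = (n == m)%:R.
Proof.
have [lt_nm|gt_nm|->] := ltngtP n m; rewrite -[psX ^+ m]mulr1; first exact: psXnM_low.
  rewrite -(subnKC (ltnW gt_nm)) psXnM.
  by move: gt_nm; rewrite -subn_gt0; case: (n - m)%N.
by have := psXnM m 1 0; rewrite addn0 => ->.
Qed.

Lemma psXn_divides f m : (forall n, (n < m)%N -> f n = 0) -> exists g, f = psX ^+ m * g.
Proof.
move=> f0; exists (fun n => f (m + n)%N); apply/funext => n.
have [lt_nm|le_mn] := ltnP n m; first by rewrite f0 // psXnM_low.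
by rewrite -(subnKC le_mn) psXnM.
Qed.

Lemma ps_order f : f != 0 -> exists n g, f = psX ^+ n * g /\ g 0%N != 0.
Proof.
move=> f_neq0; have ex_n : exists n, f n != 0.
  apply: contrapT => f0; case/negP: f_neq0; apply/eqP/funext => n.
  by apply/eqP/negPn/negP => fn; apply: f0; exists n.
case: (ex_minnP ex_n) => n fn n_min.
have [|g def_f] := @psXn_divides f n.
  by move=> m lt_mn; apply/eqP; apply: contraLR lt_mn => /n_min; rewrite leqNgt.
by exists n, g; split=> //; move: fn; rewrite def_f -{2}(addn0 n) psXnM.
Qed.

Lemma psXn_inj m f g : psX ^+ m * f = psX ^+ m * g -> f = g.
Proof. by move=> eqfg; apply/funext => n; rewrite -(psXnM m) eqfg psXnM. Qed.

(** The type [{fraction _}] expects an integral domain with a unit ring structure, so an inverse is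
    chosen classically here. *)
Definition ps_unit : pred ps := fun f => `[< exists g, g * f = 1 >].
Definition ps_inv f : ps := if pselect (exists g, g * f = 1) is left e then sval (cid e) else f.

Lemma ps_mulVr : {in ps_unit, left_inverse 1 ps_inv *%R}.
Proof.
move=> f /asboolP f_unit; rewrite /ps_inv; case: pselect => // e.
by case: cid.
Qed.

Lemma ps_unitP f g : g * f = 1 -> ps_unit f.
Proof. by move=> gf1; apply/asboolP; exists g. Qed.

Lemma ps_inv_out : {in [predC ps_unit], ps_inv =1 id}.
Proof.
move=> f /negP f_nonunit; rewrite /ps_inv; case: pselect => // e.
by case: f_nonunit; apply/asboolP.
Qed.

HB.instance Definition _ := GRing.ComNzRing_hasMulInverse.Build ps
  ps_mulVr ps_unitP ps_inv_out.

Lemma ps_integral : GRing.integral_domain_axiom ps.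
Proof.
move=> f g fg0; apply: contraT => /norP [/ps_order [n [f' [fE f'0]]] /ps_order [m [g' [gE g'0]]]].
have /psXn_inj /(congr1 (@^~ 0%N)) /eqP : psX ^+ (n + m) * (f' * g') = psX ^+ (n + m) * 0.
  by rewrite mulr0 exprD mulrACA -fE -gE.
by rewrite psM0 mulf_eq0 (negPf f'0) (negPf g'0).
Qed.

HB.instance Definition _ := GRing.ComUnitRing_isIntegral.Build ps ps_integral.

Lemma psX_neq0 : psX != 0.
Proof. by apply/eqP => /(congr1 (@^~ 1%N)) /eqP; rewrite /= oner_eq0. Qed.

Lemma ps_inverse f : f 0%N != 0 -> exists g, g * f = 1.
Proof.
move=> f0.
(* The equations for the coefficients of the inverse are triangular: [step] solves the next one, and
   [s n] lists the first [n] solutions. *)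
pose step (s : seq k) := rcons s ((f 0%N)^-1 *
  ((size s == 0)%:R - \sum_(i < size s) s`_i * f (size s - i)%N)).
pose s n := iter n step [::].
have size_s n : size (s n) = n by elim: n => //= n IH; rewrite size_rcons IH.
pose g : ps := fun n => (s n.+1)`_n.
have sE n i : (i < n)%N -> (s n)`_i = g i.
  elim: n => // n IH; rewrite ltnS leq_eqVlt => /predU1P [-> //|lt_in].
  by rewrite /= /step nth_rcons size_s lt_in IH.
exists g; apply/funext => n; rewrite psM /ps_mul big_ord_recr /= subnn.
have -> : g n * f 0%N = (n == 0%N)%:R - \sum_(i < n) g i * f (n - i)%N.
  have -> : g n = (step (s n))`_n by [].
  rewrite /step nth_rcons size_s ltnn eqxx mulrAC mulVf // mul1r.
  by congr (_ - _); apply: eq_bigr => i _; rewrite sE.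
by rewrite addrC subrK ps1; case: n.
Qed.

Definition ps_deriv f : ps := fun n => f n.+1 *+ n.+1.

Lemma ps_derivD : {morph ps_deriv : f g / f + g}.
Proof. by move=> f g; apply/funext => n; rewrite /ps_deriv psD mulrnDl. Qed.

Lemma ps_derivM f g : ps_deriv (f * g) = ps_deriv f * g + f * ps_deriv g.
Proof.
apply/funext => n; rewrite psD !psM.
have -> : ps_deriv (f * g) n = ps_mul f g n.+1 *+ n.+1 by [].
(* The truncation is at [n.+2] because coefficient [n] of a derivative reads coefficient [n.+1]. *)
have dT h i : (i <= n)%N -> (truncation n.+2 h)^`()`_i = ps_deriv h i.
  by move=> le_in; rewrite coef_deriv coef_truncation.
rewrite (@ps_mulE f g n.+2) // -coef_deriv derivM coefD.
by congr (_ + _); apply: ps_mul_coef => i le_in;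
   rewrite ?dT ?coef_truncation // ltnS leqW.
Qed.

Lemma ps_deriv_const c : ps_deriv (ps_const c) = 0.
Proof. by apply/funext => n; rewrite /ps_deriv mul0rn. Qed.

Lemma ps_deriv_psX : ps_deriv psX = 1.
Proof. by apply/funext => -[|n]; rewrite /ps_deriv /psX ?mul0rn. Qed.

End PowerSeries.

Section Laurent.
Variable k : fieldType.
Local Notation ps := (power_series k).
Local Notation laurent := {fraction (power_series k)}.
Local Notation "x %:L" := (@FracField.tofrac ps x) (at level 2, format "x %:L").
Local Notation X := (@psX k).
Implicit Types (z w : laurent) (c : k).

(* [w n] is then the coefficient of [X^-1] in the Laurent series [z]. *)
Definition is_laurent_residue z c :=
  exists n (w : ps), z * X%:L ^+ n.+1 = w%:L /\ w n = c.

Lemma tofrac_inj : injective (@FracField.tofrac ps).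
Proof. by move=> f g /eqP; rewrite tofrac_eq => /eqP. Qed.

Lemma laurent_residue_uniq z c c' :
  is_laurent_residue z c -> is_laurent_residue z c' -> c = c'.
Proof.
move=> [n [w [zw <-]]] [n' [w' [zw' <-]]].
have : X ^+ n'.+1 * w = X ^+ n.+1 * w'.
  by apply: tofrac_inj; rewrite !tofracM !tofracXn -zw -zw' mulrCA [RHS]mulrCA;
     congr (_ * _); apply: mulrC.
move/(congr1 (@^~ (n' + n).+1)) => /=.
by rewrite -{1}addSn psXnM addnC -addSn psXnM.
Qed.

Lemma laurent_residueD z w c c' : is_laurent_residue z c -> is_laurent_residue w c' ->
  is_laurent_residue (z + w) (c + c').
Proof.
move=> [n [f [zf <-]]] [n' [g [wg <-]]].
exists (n + n')%N, (X ^+ n' * f + X ^+ n * g); split.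
  by rewrite tofracD !tofracM !tofracXn -zf -wg mulrDl; congr (_ + _);
    rewrite mulrCA -exprD ?addnS // addnC.
by rewrite psD psXnM addnC psXnM.
Qed.

Lemma laurent_residueZ z c c' : is_laurent_residue z c ->
  is_laurent_residue ((ps_const c')%:L * z) (c' * c).
Proof.
move=> [n [f [zf <-]]]; exists n, (ps_const c' * f); split.
  by rewrite tofracM -zf mulrA.
by rewrite ps_constM.
Qed.

Lemma laurent_residue_integral (f : ps) : is_laurent_residue f%:L 0.
Proof.
exists 0%N, (X * f); split; last by rewrite psXM.
by rewrite tofracM mulrC expr1.
Qed.

Lemma laurent_residue_pole (f : ps) n :
  is_laurent_residue (f%:L / X%:L ^+ n.+1) (f n).
Proof.
exists n, f; split=> //; rewrite divfK // expf_neq0 //.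
by rewrite tofrac_eq0 psX_neq0.
Qed.

End Laurent.

(** * Taylor expansion along a uniformizer *)


Section Taylor.
Variables (k : fieldType) (B : comAlgType k) (m : B -> Prop) (t : B).

(* The localization of [B] at [m] is an almost discrete valuation ring with
   residue field [k]: the intersection of the powers of [m] may be nonzero. *)
Record uniformized : Prop := Uniformized {
  unif_prime : is_prime_ideal m;
  unif_residue : forall b, exists c : k, m (b - c%:A);
  unif_mem : m t;
  unif_nzd : forall x, t * x = 0 -> x = 0;
  unif_gen : forall b, m b -> exists s c, ~ m s /\ s * b = c * t
}.

Hypothesis mt : uniformized.

Let m0 : m 0. Proof. by case: (unif_prime mt) => -[]. Qed.
Let mD x y : m x -> m y -> m (x + y).
Proof. by case: (unif_prime mt) => -[_ mD _] _ _; apply: mD. Qed.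
Let mM r x : m x -> m (r * x).
Proof. by case: (unif_prime mt) => -[_ _ mM] _ _; apply: mM. Qed.
Let m1 : ~ m 1. Proof. by case: (unif_prime mt). Qed.
Let mB x y : m x -> m y -> m (x - y).
Proof. by move=> mx my; rewrite -(mulN1r y); apply: mD => //; apply: mM. Qed.
Lemma unif_notM s s' : ~ m s -> ~ m s' -> ~ m (s * s').
Proof. by case: (unif_prime mt) => _ _ mP Ns Ns' /mP []. Qed.

Lemma unif_scalar (c : k) : m c%:A -> c = 0.
Proof.
move=> mc; apply: contrapT => /eqP c0; apply: m1.
have -> : 1 = (c^-1)%:A * c%:A :> B by rewrite -scalerAl mul1r scalerA mulVf // scale1r.
exact: mM.
Qed.

Lemma unif_powK n x y : t ^+ n * x = t ^+ n * y -> x = y.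
Proof.
move=> /eqP; rewrite -subr_eq0 -mulrBr => /eqP txy.
apply/eqP; rewrite -subr_eq0; apply/eqP; elim: n txy => [|n IH]; first by rewrite mul1r.
by rewrite exprS -mulrA => /(unif_nzd mt).
Qed.

(** Congruence of [b] and [q] evaluated at [t], modulo [t ^+ n] in the localization at [m], with
    denominators cleared. The degree of [q] is unrestricted, so only its coefficients below [n] are
    meaningful. *)
Definition taylor_poly n b (q : {poly k}) :=
  exists s r, ~ m s /\ s * (b - horner_alg t q) = r * t ^+ n.

Lemma taylor_polyD n b b' q q' : taylor_poly n b q -> taylor_poly n b' q' ->
  taylor_poly n (b + b') (q + q').
Proof.
move=> [s [r [Ns sb]]] [s' [r' [Ns' sb']]]; exists (s * s'), (s' * r + s * r').
split; first exact: unif_notM.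
by rewrite rmorphD mulrDl -!mulrA -sb -sb' /=; ring.
Qed.

Lemma taylor_polyM n b b' q q' : taylor_poly n b q -> taylor_poly n b' q' ->
  taylor_poly n (b * b') (q * q').
Proof.
move=> [s [r [Ns sb]]] [s' [r' [Ns' sb']]].
exists (s * s'), (s' * b' * r + s * horner_alg t q * r').
split; first exact: unif_notM.
by rewrite rmorphM mulrDl -!mulrA -sb -sb' /=; ring.
Qed.

Lemma taylor_poly_horner n q : taylor_poly n (horner_alg t q) q.
Proof. by exists 1, 0; rewrite subrr mulr0 mul0r. Qed.

Lemma taylor_poly_le n n' b q : (n' <= n)%N -> taylor_poly n b q -> taylor_poly n' b q.
Proof.
move=> le_n [s [r [Ns sb]]]; exists s, (r * t ^+ (n - n')); split=> //.
by rewrite sb -mulrA -exprD subnK.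
Qed.

Lemma taylor_poly_exists n b : exists q, taylor_poly n b q.
Proof.
elim: n => [|n [q [s [r [Ns sb]]]]].
  by exists 0, 1, (b - horner_alg t 0); rewrite mul1r mulr1.
(* The remainder [r / s] has value [c / e] at the point, which is the next Taylor coefficient; [e]
   is nonzero because [s] is outside [m]. *)
have [[c mr] [e ms]] := (unif_residue mt r, unif_residue mt s).
have e0 : e != 0 by apply: contra_notN Ns => /eqP e0; move: ms; rewrite e0 scale0r subr0.
have : m (r - s * (c / e)%:A).
  have -> : r - s * (c / e)%:A = (r - c%:A) - (c / e)%:A * (s - e%:A).
    have -> : c%:A = (c / e)%:A * e%:A :> B by rewrite -scalerAl mul1r scalerA divfK.
    by ring.
  by apply: mB => //; apply: mM.
move=> /(unif_gen mt) [s' [r' [Ns' sr']]].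
exists (q + (c / e) *: 'X^n), (s' * s), r'; split; first exact: unif_notM.
rewrite rmorphD /= linearZ /= rmorphXn /= horner_algX exprS mulrA -sr' -mulrA.
rewrite -mulr_algl opprD addrA mulrBr sb mulrA; ring.
Qed.

(** Uniqueness of Taylor coefficients. Once ['X^j] is split off, cancelling [t ^+ j] leaves a
    positive power of [t] on the right, so the constant term of the cofactor lies in [m] and is
    0. *)
Lemma taylor_poly_low n q : taylor_poly n 0 q -> forall i, (i < n)%N -> q`_i = 0.
Proof.
move=> [s [r [Ns sq]]].
suff low j : (j <= n)%N -> exists q', q = 'X^j * q'.
  by have [q' ->] := low n (leqnn n); move=> i lt_in; rewrite coefXnM lt_in.
elim: j => [|j IH] lt_jn; first by exists q; rewrite mul1r.
have [q' def_q] := IH (ltnW lt_jn).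
have q'0 : q'`_0 = 0.
  have /unif_powK sq' : t ^+ j * (- s * horner_alg t q') = t ^+ j * (r * t ^+ (n - j)).
    rewrite [RHS]mulrCA -exprD subnKC ?(ltnW lt_jn) // -sq def_q rmorphM /= rmorphXn /=.
    by rewrite horner_algX; ring.
  have [q'' [q'c]] : exists q'', q' = q'' * 'X + (q'`_0)%:P.
    by elim/poly_ind: q' {def_q sq'} => [|p c _]; [exists 0; rewrite coef0 mul0r add0r polyC0|
      exists p; rewrite coefD coefMX coefC add0r].
  apply: unif_scalar; apply: contrapT => Nc.
  have mNsq : m (s * horner_alg t q').
    rewrite -[s]opprK mulNr sq' -mulN1r; apply: mM.
    rewrite -(subnKC lt_jn) subSn; last exact: leq_addr.
    by rewrite exprSr; do 2!apply: mM; apply: unif_mem mt.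
  have : m (horner_alg t q') by case: (unif_prime mt) => _ _ /(_ _ _ mNsq) [].
  rewrite q'c rmorphD rmorphM /= horner_algX horner_algC => mq'.
  apply: Nc; rewrite -(addKr (horner_alg t q'' * t) (q'`_0)%:A) addrC.
  by apply: mB => //; apply: mM; apply: unif_mem mt.
have [q'' q'E] : exists q'', q' = 'X * q''.
  exists (\poly_(i < size q') q'`_i.+1); apply/polyP => -[|i]; rewrite coefXM //= coef_poly.
  by case: ltnP => // /leqW /(nth_default _) ->.
by exists q''; rewrite def_q q'E exprSr mulrA.
Qed.

(** Coefficient [i] is read off an approximation of order [i.+1], the least that determines it; by
    [taylorE] any other approximation of larger order gives the same value. *)
Definition taylor b : power_series k :=
  fun i => (xget 0 [set q | taylor_poly i.+1 b q])`_i.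

Lemma taylorE n b q : taylor_poly n b q -> forall i, (i < n)%N -> taylor b i = q`_i.
Proof.
move=> bq i lt_in; have := xgetPex 0 (taylor_poly_exists i.+1 b).
rewrite /taylor; set q' := xget _ _ => bq'.
apply/eqP; rewrite -subr_eq0 -coefB; apply/eqP.
apply: (@taylor_poly_low i.+1) => //.
have /taylor_polyD -/(_ _ _ bq') :=
  taylor_polyM (taylor_poly_horner i.+1 (-1)) (taylor_poly_le lt_in bq).
by rewrite rmorphN1 !mulN1r addNr addrC.
Qed.

Lemma taylor_poly_truncation n b : exists2 q, taylor_poly n b q &
  forall i, (i < n)%N -> q`_i = taylor b i.
Proof.
have [q bq] := taylor_poly_exists n b.
by exists q => // i lt_in; rewrite (taylorE bq).
Qed.

Lemma taylor_is_zmod_morphism : zmod_morphism taylor.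
Proof.
move=> b c; apply/funext => n; rewrite psD psN.
have [[q bq qE] [q' cq' q'E]] := (taylor_poly_truncation n.+1 b, taylor_poly_truncation n.+1 c).
have := taylor_polyM (taylor_poly_horner n.+1 (-1)) cq'.
rewrite rmorphN1 !mulN1r => /(taylor_polyD bq) /taylorE -> //.
by rewrite coefB qE ?q'E.
Qed.

Lemma taylor_is_monoid_morphism : monoid_morphism taylor.
Proof.
split=> [|b c]; apply/funext => n.
  have := taylor_poly_horner n.+1 1; rewrite rmorph1 => /taylorE -> //.
  by rewrite coef1 ps1; case: n.
have [[q bq qE] [q' cq' q'E]] := (taylor_poly_truncation n.+1 b, taylor_poly_truncation n.+1 c).
rewrite (taylorE (taylor_polyM bq cq')) // psM.
by apply: ps_mul_coef => i le_in; rewrite ?qE ?q'E.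
Qed.

Lemma taylor_t : taylor t = psX k.
Proof.
apply/funext => n; have := taylor_poly_horner n.+1 'X.
by rewrite horner_algX => /taylorE -> //; rewrite coefX.
Qed.

Lemma taylor_scalar c : taylor c%:A = ps_const c.
Proof.
apply/funext => n; have := taylor_poly_horner n.+1 c%:P.
by rewrite horner_algC => /taylorE -> //; rewrite coefC; case: n.
Qed.

Lemma taylor0P b : taylor b 0%N = 0 <-> m b.
Proof.
have [q bq qE] := taylor_poly_truncation 1 b; rewrite -qE //.
have [c mc] := unif_residue mt b.
have bc : taylor_poly 1 b c%:P.
  have [s [r [Ns sb]]] := unif_gen mt mc.
  by exists s, r; rewrite horner_algC expr1.
have -> : q`_0 = c by rewrite qE // (taylorE bc) // coefC.
split=> [c0|mb]; first by rewrite c0 scale0r subr0 in mc.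
by apply: unif_scalar; rewrite -[c%:A](subKr b); apply: mB.
Qed.

(** Brings divisibility by a power of the variable back from series to the localization. A finite
    approximation is enough, so a possible kernel of [taylor] does no harm. *)
Lemma taylor_lift n b g : taylor b = psX k ^+ n * g ->
  exists s r, [/\ ~ m s, s * b = r * t ^+ n & g 0%N != 0 -> ~ m r].
Proof.
(* Order [n.+1] rather than [n], so that the leading coefficient [g 0] is visible too. *)
move=> bE; have [q bq qE] := taylor_poly_truncation n.+1 b.
have [q' q'E] : exists q', q = 'X^n * q'.
  exists (drop_poly n q); rewrite mulrC -[LHS](poly_take_drop n).
  suff -> : take_poly n q = 0 by rewrite add0r.
  apply/polyP => i; rewrite coef_take_poly coef0; case: ltnP => // lt_in.
  by rewrite qE ?bE ?psXnM_low // ltnS ltnW.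
have [s [r [Ns sb]]] := bq; exists s, (r * t + s * horner_alg t q'); split=> //.
  move: sb; rewrite q'E rmorphM /= rmorphXn /= horner_algX => /eqP.
  by rewrite mulrBr subr_eq => /eqP ->; rewrite exprS; ring.
have g0 : g 0%N = q'`_0.
  have := qE n (ltnSn n); rewrite bE q'E.
  have := psXnM n g 0; rewrite addn0 => -> <-.
  by rewrite coefXnM ltnn subnn.
move=> gn0 mr.
have : m (s * horner_alg t q').
  rewrite -(addKr (r * t) (s * _)) addrC; apply: mB => //.
  by apply: mM; apply: unif_mem mt.
case: (unif_prime mt) => _ _ mP /mP [//|].
have /taylorE /(_ 0%N isT) := taylor_poly_horner 1 q'.
by rewrite -g0 => q'0 /taylor0P; rewrite q'0 => /eqP; apply/negP.
Qed.

End Taylor.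

(** * Modules and Kaehler differentials *)


Section RestrictScalars.
Variables (K S : comNzRingType) (L : {rmorphism K -> S}) (N : lmodType S).

(** The argument [L] is a phantom that lets the module structure depend on the morphism. It serves
    twice: to make a field a module over [K], and to view differentials as a module over [A] for
    Nakayama's lemma. *)
Definition restrict_scalars of {rmorphism K -> S} : Type := N.
Local Notation NL := (restrict_scalars L).

HB.instance Definition _ := GRing.Zmodule.on NL.

Let scale (a : K) (x : NL) : NL := L a *: (x : N).
Let scaleA a b x : scale a (scale b x) = scale (a * b) x.
Proof. by rewrite /scale scalerA rmorphM. Qed.
Let scale1 : left_id 1 scale.
Proof. by move=> x; rewrite /scale rmorph1 scale1r. Qed.
Let scaleDr : right_distributive scale +%R.
Proof. by move=> a x y; rewrite /scale scalerDr. Qed.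
Let scaleDl x : {morph scale^~ x : a b / a + b}.
Proof. by move=> a b; rewrite /scale rmorphD scalerDl. Qed.

HB.instance Definition _ :=
  GRing.Zmodule_isLmodule.Build K NL scaleA scale1 scaleDr scaleDl.
End RestrictScalars.

Section Submodule.
Variables (K : comNzRingType) (M : lmodType K) (S : M -> Prop).

Record is_submodule : Prop := IsSubmodule {
  submodule0 : S 0;
  submoduleD : forall x y, S x -> S y -> S (x + y);
  submoduleZ : forall a x, S x -> S (a *: x)
}.

Hypothesis SP : is_submodule.

Definition submodule_pred of is_submodule : {pred M} := fun x => `[< S x >].
Local Notation Sb := (submodule_pred SP).

Let Sb_closed : submod_closed Sb.
Proof.
split=> [|a x y /asboolP Sx /asboolP Sy]; first by apply/asboolP; apply: submodule0.
by apply/asboolP; apply: submoduleD => //; apply: submoduleZ.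
Qed.
HB.instance Definition _ := GRing.isSubmodClosed.Build K M Sb Sb_closed.
Definition submodule_type := {x | x \in Sb}.
HB.instance Definition _ := SubType.on submodule_type.
HB.instance Definition _ := Choice.on submodule_type.
HB.instance Definition _ := [SubChoice_isSubLmodule of submodule_type by <:].
End Submodule.

Section Kaehler.
Variables (k : closedFieldType) (K : comUnitAlgType k) (M : lmodType K) (d : K -> M).
Hypothesis hd : is_kaehler d.

(** Corestricting [d] to the submodule gives a map from [M] into it; its composite with the
    inclusion fixes every [d x], hence is the identity by uniqueness. *)
Lemma kaehler_span (S : M -> Prop) : is_submodule S -> (forall x, S (d x)) ->
  forall eta, S eta.
Proof.
move=> SP Sd eta; have Sd' x : d x \in submodule_pred SP by apply/asboolP.
pose d' x : submodule_type SP := Sub (d x) (Sd' x).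
have [[dD dZ dM] univ] := hd.
have d'P : is_derivation d'.
  by split=> *; apply: val_inj; rewrite /= ?linearD ?linearZ /= ?SubK;
    [apply: dD|apply: dZ|apply: dM].
have [[phi phiE] _] := univ _ _ d'P.
have [_ /(_ (\val \o phi) idfun) uniq] := univ _ _ (And3 dD dZ dM).
have <- : val (phi eta) = eta by apply: uniq => x //=; rewrite phiE.
by apply/asboolP; apply: (valP (phi eta)).
Qed.

Lemma kaehler_lift (F : comNzRingType) (L : {rmorphism K -> F}) (D : K -> F) :
  (forall x y, D (x + y) = D x + D y) -> (forall c : k, D c%:A = 0) ->
  (forall x y, D (x * y) = L x * D y + L y * D x) ->
  exists phi : M -> F, [/\ (forall x y, phi (x + y) = phi x + phi y),
    (forall a x, phi (a *: x) = L a * phi x) & (forall x, phi (d x) = D x)].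
Proof.
move=> DD Dc DM; have [_ univ] := hd.
have [|[phi phiE] _] := univ (restrict_scalars F^o L : lmodType K) D.
  split=> // c x; rewrite -[in LHS]mulr_algl DM Dc mulr0 addr0.
  by [].
exists phi; split=> // [x y|a x]; first exact: raddfD.
by rewrite linearZ.
Qed.
End Kaehler.

Section ExtendDerivation.
Variables (B K : comNzRingType) (iB : {rmorphism B -> K}) (F : fieldType).
Variables (T : {rmorphism B -> F}) (D : B -> F).
Hypothesis iB_inj : injective iB.
Hypothesis DD : forall x y, D (x + y) = D x + D y.
Hypothesis DM : forall x y, D (x * y) = T x * D y + T y * D x.
Hypothesis frac : forall z, exists b c, T c != 0 /\ iB c * z = iB b.

Let L z : F := xget 0 (fun w => exists b c, [/\ T c != 0, iB c * z = iB b & w = T b / T c]).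
Let E z : F := xget 0 (fun w => exists b c, [/\ T c != 0, iB c * z = iB b &
  w = (D b - D c * (T b / T c)) / T c]).

Let cross b c b' c' z : iB c * z = iB b -> iB c' * z = iB b' -> c * b' = c' * b.
Proof. by move=> zb zb'; apply: iB_inj; rewrite !rmorphM -zb -zb'; ring. Qed.

Let LE b c z : T c != 0 -> iB c * z = iB b -> L z = T b / T c.
Proof.
move=> Tc zb; apply: xget_unique; first by exists b, c.
move=> _ [b' [c' [Tc' zb' ->]]].
have := congr1 T (cross zb zb'); rewrite !rmorphM => cb.
by apply/eqP; rewrite eqr_div // mulrC cb mulrC.
Qed.

Let EE b c z : T c != 0 -> iB c * z = iB b -> E z = (D b - D c * (T b / T c)) / T c.
Proof.
move=> Tc zb; apply: xget_unique; first by exists b, c.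
move=> _ [b' [c' [Tc' zb' ->]]].
have cb := cross zb zb'.
have := congr1 D cb; have := congr1 T cb; rewrite !rmorphM !DM => Tcb Dcb.
have -> : T b' = T c' * T b / T c by rewrite -Tcb mulrAC divff ?mul1r.
have -> : D b' = (T c' * D b + T b * D c' - T b' * D c) / T c.
  by rewrite -Dcb addrK mulrAC divff ?mul1r.
have -> : T b' = T c' * T b / T c by rewrite -Tcb mulrAC divff ?mul1r.
by field; rewrite Tc.
Qed.

(** The quotient rule. A fraction is picked by choice for each element of [K]; two fractions of the
    same element satisfy [c * b' = c' * b] in [B], and applying [T] and [D] to this shows that [L]
    and [E] do not depend on the choice. *)
Lemma extend_derivation : exists (L : {rmorphism K -> F}) (E : K -> F),
  [/\ forall b, L (iB b) = T b, forall b, E (iB b) = D b,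
      forall x y, E (x + y) = E x + E y &
      forall x y, E (x * y) = L x * E y + L y * E x].
Proof.
have sumK x y b c b' c' : iB c * x = iB b -> iB c' * y = iB b' ->
    iB (c * c') * (x + y) = iB (b * c' + c * b').
  by move=> xb yb; rewrite rmorphD !rmorphM -xb -yb; ring.
have mulK x y b c b' c' : iB c * x = iB b -> iB c' * y = iB b' ->
    iB (c * c') * (x * y) = iB (b * b').
  by move=> xb yb; rewrite !rmorphM -xb -yb; ring.
have LB b : L (iB b) = T b.
  by rewrite (@LE b 1) ?rmorph1 ?oner_neq0 ?mul1r ?divr1.
have D1 : D 1 = 0.
  by have := DM 1 1; rewrite mulr1 rmorph1 mul1r => /eqP; rewrite -subr_eq subrr eq_sym => /eqP.
have EB b : E (iB b) = D b.
  by rewrite (@EE b 1) ?rmorph1 ?oner_neq0 ?mul1r ?divr1 // D1 mul0r subr0.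
have TM c c' : T c != 0 -> T c' != 0 -> T (c * c') != 0.
  by move=> Tc Tc'; rewrite rmorphM mulf_neq0.
have LD x y : L (x + y) = L x + L y.
  have [[b [c [Tc xb]]] [b' [c' [Tc' yb]]]] := (frac x, frac y).
  rewrite (LE (TM _ _ Tc Tc') (sumK _ _ _ _ _ _ xb yb)) (LE Tc xb) (LE Tc' yb).
  by rewrite rmorphD !rmorphM; field; rewrite Tc Tc'.
have LM x y : L (x * y) = L x * L y.
  have [[b [c [Tc xb]]] [b' [c' [Tc' yb]]]] := (frac x, frac y).
  rewrite (LE (TM _ _ Tc Tc') (mulK _ _ _ _ _ _ xb yb)) (LE Tc xb) (LE Tc' yb).
  by rewrite !rmorphM; field; rewrite Tc Tc'.
have LN : {morph L : x / - x}.
  move=> x; apply/eqP; rewrite -addr_eq0 -LD addNr; apply/eqP.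
  by rewrite -(rmorph0 iB) LB rmorph0.
have L_zmod : zmod_morphism L by move=> x y; rewrite LD LN.
have L_mon : monoid_morphism L by split=> //; rewrite -(rmorph1 iB) LB rmorph1.
pose L' : {rmorphism K -> F} := HB.pack L (GRing.isZmodMorphism.Build _ _ L L_zmod)
  (GRing.isMonoidMorphism.Build _ _ L L_mon).
exists L', E; split=> // x y.
  have [[b [c [Tc xb]]] [b' [c' [Tc' yb]]]] := (frac x, frac y).
  rewrite (EE (TM _ _ Tc Tc') (sumK _ _ _ _ _ _ xb yb)) (EE Tc xb) (EE Tc' yb).
  by rewrite rmorphD !DD !DM !rmorphM; field; rewrite Tc Tc'.
have [[b [c [Tc xb]]] [b' [c' [Tc' yb]]]] := (frac x, frac y).
rewrite /= (EE (TM _ _ Tc Tc') (mulK _ _ _ _ _ _ xb yb)) (EE Tc xb) (EE Tc' yb).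
rewrite (LE Tc xb) (LE Tc' yb).
by rewrite !DM !rmorphM; field; rewrite Tc Tc'.
Qed.
End ExtendDerivation.

Section LocalRing.
Variables (R : comUnitRingType).
Hypothesis R_local : forall a : R, a \is a GRing.unit \/ 1 - a \is a GRing.unit.

Lemma nonunits_prime : is_prime_ideal (fun a : R => a \isn't a GRing.unit).
Proof.
split; last 2 first.
- by rewrite unitr1.
- by move=> x y; rewrite unitrM negb_and => /orP.
split=> [|x y /negP Nx /negP Ny|r x]; first by rewrite unitr0.
  apply/negP => Uxy; have [Ux|] := R_local (x / (x + y)).
    by apply: Nx; rewrite -(divrK Uxy x) unitrM Ux.
  have -> : 1 - x / (x + y) = y / (x + y).
    by rewrite -{1}(divrr Uxy) -mulrBl [x + y]addrC addrK.
  move=> Uy.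
  by apply: Ny; rewrite -(divrK Uxy y) unitrM Uy.
by rewrite unitrM negb_and orbC => ->.
Qed.
End LocalRing.

Section Nakayama.
Variables (R : comUnitRingType) (M : lmodType R) (t : R) (N : M -> Prop).
Hypothesis t_radical : forall a, 1 - a * t \is a GRing.unit.
Hypothesis N_sub : is_submodule N.

(** Membership in [N] plus the span of [s], recursive so that generators can be eliminated one at a
    time. *)
Fixpoint span_over (s : seq M) (x : M) : Prop :=
  if s is y :: s' then exists a x', span_over s' x' /\ x = a *: y + x' else N x.

Lemma span_over_sub s : is_submodule (span_over s).
Proof.
elim: s => //= y s [s0 sD sZ].
split=> [|x x' [a [z [sz ->]]] [a' [z' [sz' ->]]]|b x [a [z [sz ->]]]].
- by exists 0, 0; rewrite scale0r addr0.
- by exists (a + a'), (z + z'); split; [exact: sD|rewrite scalerDl addrACA].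
- by exists (b * a), (b *: z); split; [exact: sZ|rewrite scalerDr scalerA].
Qed.

Lemma span_over_base s x : N x -> span_over s x.
Proof. by elim: s => //= y s IH Nx; exists 0, x; rewrite scale0r add0r; split=> //; apply: IH. Qed.

Lemma span_over_mem s x : x \in s -> span_over s x.
Proof.
elim: s => //= y s IH; have [s0 sD sZ] := span_over_sub s.
rewrite in_cons => /predU1P [->|/IH sx]; first by exists 1, 0; rewrite scale1r addr0.
by exists 0, x; rewrite scale0r add0r.
Qed.

(** The head generator satisfies [y = n + t *: (a *: y + z)]; as [1 - a * t] is a unit, this is
    solved for [y], which thus becomes redundant and can be substituted away in the other
    relations. *)
Lemma nakayama s :
  (forall x, x \in s -> exists n y, [/\ N n, span_over s y & x = n + t *: y]) ->
  forall x, span_over s x -> N x.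
Proof.
have [N0 ND NZ] := N_sub.
elim: s => //= y s IH sP; have [s0 sD sZ] := span_over_sub s.
have sy : exists n z, [/\ N n, span_over s z & y = n + t *: z].
  have [n [_ [Nn [a [z [sz ->]]] yE]]] := sP y (mem_head _ _).
  have U := t_radical a; exists ((1 - a * t)^-1 *: n), ((1 - a * t)^-1 *: z).
  split; [exact: NZ|exact: sZ|].
  have yE' : (1 - a * t) *: y = n + t *: z.
    rewrite scalerBl scale1r {1}yE scalerDr scalerA [t * a]mulrC.
    by rewrite addrCA addrC addrK.
  by rewrite scalerA [t * _]mulrC -scalerA -scalerDr -yE' scalerA mulVr ?scale1r.
have [n0 [z0 [Nn0 sz0 yE]]] := sy.
have sN x : span_over (y :: s) x -> span_over s x.
  move=> [a [x' [sx' ->]]]; apply: (sD) => //; apply: (sZ); rewrite yE.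
  by apply: (sD); [exact: span_over_base|apply: sZ].
move=> x /sN; apply: IH => z sz.
have [|n [w [Nn /sN sw zE]]] := sP z; first by rewrite in_cons sz orbT.
by exists n, w.
Qed.
End Nakayama.

(** * Linear constraints *)


Section CutOut.
Variables (k : closedFieldType) (V : vectType k).
Implicit Types (S : V -> Prop) (U : {vspace V}).

(** A subspace of largest dimension inside [S] is all of [S], since any further vector of [S] would
    enlarge it. *)
Lemma submodule_vspace S : is_submodule S -> exists U, forall v, S v <-> v \in U.
Proof.
move=> [S0 SD SZ].
pose P n := `[< exists U, (forall v, v \in U -> S v) /\ \dim U = n >].
have exP : exists n, P n.
  by exists 0%N; apply/asboolP; exists 0%VS; rewrite dimv0; split=> // v; rewrite memv0 => /eqP ->.
have ubP n : P n -> (n <= \dim {:V})%N.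
  by move=> /asboolP [U [_ <-]]; apply/dimvS/subvf.
have [n /asboolP [U [US dimU]] n_max] := ex_maxnP exP ubP.
exists U => v; split=> [Sv|]; last exact: US.
apply: contraT => NUv.
have /n_max : P (\dim (U + <[v]>)%VS).
  apply/asboolP; exists (U + <[v]>)%VS; split=> // w /memv_addP [u uU [_ /vlineP [c ->] ->]].
  by apply: SD; [exact: US|exact: SZ].
rewrite -dimU => /(conj (addvSl U <[v]>)) /andP; rewrite -eqEdim => /eqP UE.
by case/negP: NUv; rewrite UE; apply: subvP (addvSr U _) _ (memv_line v).
Qed.

Lemma cut_out_dim U n : cut_out_by (fun v => v \in U) n -> (n + \dim U = \dim {:V})%N.
Proof.
move=> [phi [phi_free phiU]].
pose f0 v : 'rV[k]_n := \row_i tnth phi i v.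
have f_lin : linear f0 by move=> a u v; apply/rowP => i; rewrite !mxE linearP.
pose f : {linear V -> 'rV[k]_n} := HB.pack f0 (GRing.isLinear.Build _ _ _ _ f0 f_lin).
have fE v i : linfun f v 0 i = tnth phi i v by rewrite lfunE mxE.
have kerf : lker (linfun f) = U.
  apply/vspaceP => v; rewrite memv_ker; apply/eqP/idP => [fv|/phiU phiv].
    by apply/phiU => i; rewrite -fE fv mxE.
  by apply/rowP => i; rewrite fE phiv mxE.
pose X := vbasis {:V}; pose G := \matrix_(j < \dim {:V}, i < n) (tnth phi i X`_j : k).
(* The columns of [G] are the forms in coordinates. Their independence makes the rows span the
   target, so the combined map is onto and rank-nullity applies. *)
have Gfull : row_full G.
  rewrite /row_full -mxrank_tr; apply: inj_row_free => r rG.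
  have sum0 : \sum_(i < n) r 0 i *: phi`_i = 0.
    apply/lfunP => v; rewrite zero_lfunE (coord_vbasis (memvf v)) linear_sum.
    apply: big1 => j _; rewrite linearZ; apply/eqP; rewrite scaler_eq0; apply/orP; right.
    apply/eqP; rewrite /= sum_lfunE; transitivity ((r *m G^T) 0 j); last by rewrite rG mxE.
    by rewrite mxE; apply: eq_bigr => i _; rewrite scale_lfunE !mxE (tnth_nth 0).
  by apply/rowP => i; rewrite mxE; move/freeP: phi_free => /(_ (r 0) sum0 i).
have fimg : limg (linfun f) = fullv.
  apply/vspaceP => e; rewrite memvf.
  have /submxP [x ex] : (e <= G)%MS by apply: submx_full.
  apply/memv_imgP; exists (\sum_j x 0 j *: X`_j); first exact: memvf.
  apply/rowP => i; rewrite fE ex mxE linear_sum.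
  by apply: eq_bigr => j _; rewrite linearZ mxE.
have := limg_ker_dim (linfun f) fullv.
by rewrite capfv kerf fimg dimvf /dim /= mul1n addnC.
Qed.

(** The forms are the coordinates of the projection to a complement of [U]. Thus [num_constraints]
    of a subspace never takes its default value. *)
Lemma cut_out_exists U : exists n, cut_out_by (fun v => v \in U) n.
Proof.
pose X := vbasis (U^C)%VS; pose pi := daddv_pi (U^C)%VS U.
have capUC : (U^C :&: U)%VS = 0%VS := etrans (capvC _ _) (capv_compl U).
pose phi0 i v : k^o := coord X i (pi v).
have phi_lin i : linear (phi0 i) by move=> a u v; rewrite /phi0 !linearP.
pose phi1 i : {linear V -> k^o} :=
  HB.pack (phi0 i) (GRing.isLinear.Build _ _ _ _ (phi0 i) (phi_lin i)).
exists (\dim (U^C)%VS), [tuple linfun (phi1 i) | i < \dim (U^C)%VS].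
have phiE i v : tnth [tuple linfun (phi1 j) | j < \dim (U^C)%VS] i v = coord X i (pi v).
  by rewrite tnth_mktuple lfunE.
have phiN (i : 'I_(\dim (U^C)%VS)) v :
    [tuple linfun (phi1 j) | j < \dim (U^C)%VS]`_i v = coord X i (pi v).
  by rewrite -phiE (tnth_nth 0).
have X_free : free X := basis_free (vbasisP _).
have X_mem (i : 'I_(\dim (U^C)%VS)) : X`_i \in (U^C)%VS.
  by apply: vbasis_mem; rewrite mem_nth ?size_tuple.
split; last first.
  move=> v; split=> [Uv i|phiv].
    rewrite phiE; suff -> : pi v = 0 by rewrite linear0.
    have := @daddv_pi_add _ _ _ _ v capUC; rewrite addvC addv_complf memvf => /(_ isT).
    rewrite [daddv_pi U _ v]daddv_pi_id ?capv_compl //.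
    by move=> /esym/eqP; rewrite -subr_eq subrr eq_sym => /eqP.
  have piv : pi v = 0.
    rewrite (coord_vbasis (memv_pi (U^C)%VS U v)) big1 // => i _.
    by rewrite -phiE phiv scale0r.
  have := @daddv_pi_add _ _ _ _ v capUC; rewrite addvC addv_complf memvf => /(_ isT).
  by rewrite -/pi piv add0r => <-; apply: memv_pi.
apply/freeP => c c0 i.
have /lfunP /(_ X`_i) := c0; rewrite zero_lfunE sum_lfunE (bigD1 i) //= big1.
  rewrite addr0 scale_lfunE phiN /pi daddv_pi_id // coord_free // eqxx => ci0.
  by rewrite -(mulr1 (c i)); apply: ci0.
move=> j ji; rewrite scale_lfunE phiN /pi daddv_pi_id // coord_free //.
by move: ji; rewrite eq_sym => /negPf ->; apply: mulr0.
Qed.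

Lemma num_constraints_lt S S' : is_submodule S -> is_submodule S' ->
  (forall v, S v -> S' v) -> (exists2 v, S' v & ~ S v) ->
  (num_constraints S' < num_constraints S)%N.
Proof.
move=> /submodule_vspace [U SU] /submodule_vspace [U' SU'] SS' [v S'v NSv].
have SE : S = (fun v => v \in U) by apply/funext => w; apply/propext.
have S'E : S' = (fun v => v \in U') by apply/funext => w; apply/propext.
have /cut_out_dim := xgetPex 0%N (cut_out_exists U).
have /cut_out_dim := xgetPex 0%N (cut_out_exists U').
rewrite /num_constraints SE S'E => <-; set a := xget _ _; set b := xget _ _.
have ltU : (\dim U < \dim U')%N.
  have UU' : (U <= U')%VS by apply/subvP => w; rewrite -SU -SU'; apply: SS'.
  rewrite ltn_neqAle dimvS // andbT; apply: contra_notN NSv => dimU.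
  have /eqP UE : U == U' by rewrite eqEdim UU' (eqP dimU) leqnn.
  by apply/SU; rewrite UE; apply/SU'.
by move=> eqab; rewrite -(ltn_add2r (\dim U)) eqab ltn_add2l.
Qed.
End CutOut.

(** * Normalization *)


Lemma is_ideal_sum (R : comNzRingType) (q : R -> Prop) (I : Type) (r : seq I) (P : pred I)
    (F : I -> R) :
  is_ideal q -> (forall i, P i -> q (F i)) -> q (\sum_(i <- r | P i) F i).
Proof. by move=> [q0 qD _] qF; elim/big_ind: _. Qed.

Lemma prime_ideal_prod (R : comNzRingType) (q : R -> Prop) (I : Type) (r : seq I) (F : I -> R) :
  is_prime_ideal q -> q (\prod_(i <- r) F i) -> exists i, q (F i).
Proof.
move=> [_ q1 qP]; elim: r => [|i r IH]; first by rewrite big_nil.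
by rewrite big_cons => /qP [|/IH //]; exists i.
Qed.

Section Normalization.
Variables (k : closedFieldType) (A : comUnitAlgType k) (B : comAlgType k) (K : comUnitAlgType k).
Variables (nu : {lrmorphism A -> B}) (iB : {lrmorphism B -> K}).
Hypothesis hA : reduced_curve_local_ring A.
Hypothesis hnu : is_normalization nu iB.

Lemma max_ideal_prime : is_prime_ideal (@max_ideal k A).
Proof. exact: nonunits_prime (rclr_local hA). Qed.

Lemma normalization_integral b : exists2 P : {poly A}, P \is monic & root (map_poly nu P) b.
Proof.
have [_ iBinj _] := hnu.
have /(nrm_closure hnu) [P Pmonic Pb] : exists b', iB b = iB b' by exists b.
exists P => //; apply/eqP/iBinj; rewrite rmorph0 -horner_map -map_poly_comp.
exact/eqP.
Qed.

Lemma over_max_ideal_proper (q : B -> Prop) a : is_prime_ideal q -> q (nu a) -> max_ideal a.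
Proof.
move=> [[_ _ qM] q1 _] qa; apply/negP => Ua; apply: q1.
by rewrite -(rmorph1 nu) -(mulVr Ua) rmorphM; apply: (qM).
Qed.

(* A maximal ideal of [B] contains every non-unit [a] of [A]: if [r] inverts
   [a] modulo it, an integral equation of [r] becomes
   [1 + a_1 a + ... + a_n a^n = 0] there, but the left-hand side is a unit. *)
Lemma lying_over : exists2 q : B -> Prop, is_prime_ideal q &
  forall a, q (nu a) <-> max_ideal a.
Proof.
have [q [qprime qmax]] := maximal_ideal_exists B.
exists q => // a; split=> [|ma]; first exact: over_max_ideal_proper.
have [qI q1 _] := qprime; have [q0 qD qM] := qI.
apply: contrapT => /qmax [r qra].
have [P Pmonic Pr] := normalization_integral r.
have [mI _ _] := max_ideal_prime; have [m0 mD mM] := mI.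
have [n sizeP] : exists n, size P = n.+1.
  by exists (size P).-1; rewrite prednK // size_poly_gt0 monic_neq0.
pose w := \sum_(i < n.+1) P`_i * a ^+ (n - i).
have Uw : w \is a GRing.unit.
  apply/negPn/negP => mw; have [_ m1 _] := max_ideal_prime; apply: m1.
  have -> : 1 = w + - 1 * \sum_(i < n) P`_i * a ^+ (n - i).
    rewrite /w big_ord_recr /= subnn mulr1.
    have /eqP := Pmonic; rewrite /lead_coef sizeP => ->.
    by rewrite mulN1r addrAC subrr add0r.
  apply: (mD) => //; apply: (mM); apply: is_ideal_sum => // i _.
  by rewrite -(prednK (_ : 0 < n - i)%N) ?subn_gt0 // exprSr mulrA; apply: (mM).
suff qw : q (nu w) by have /negP := over_max_ideal_proper qprime qw; apply.
have -> : nu w = nu w - (map_poly nu P).[r] * nu a ^+ n by rewrite (eqP Pr) mul0r subr0.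
have -> : (map_poly nu P).[r] = \sum_(i < n.+1) nu P`_i * r ^+ i.
  rewrite (@horner_coef_wide _ n.+1); last by rewrite -sizeP size_poly.
  by apply: eq_bigr => i _; rewrite coef_map.
rewrite /w rmorph_sum mulr_suml -sumrB /=; apply: is_ideal_sum => // i _.
have le_in : (i <= n)%N by rewrite -ltnS.
have -> : nu a ^+ n = nu a ^+ (n - i) * nu a ^+ i by rewrite -exprD subnK.
rewrite rmorphM rmorphXn /=.
have -> : nu P`_i * nu a ^+ (n - i) - nu P`_i * r ^+ i * (nu a ^+ (n - i) * nu a ^+ i) =
    - (nu P`_i * nu a ^+ (n - i)) * ((r * nu a) ^+ i - 1) by rewrite exprMn; ring.
apply: (qM); rewrite subrX1 mulrC; apply: (qM).
have -> : r * nu a - 1 = - 1 * (1 - r * nu a) by ring.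
exact: qM.
Qed.

Section OverPrime.
Variable q : B -> Prop.
Hypothesis q_prime : is_prime_ideal q.
Hypothesis q_over : forall a, q (nu a) <-> max_ideal a.

(** An integral equation of [b] over [A] reduces modulo [q] to one over [k], nonzero because its
    leading coefficient reduces 1. It splits into linear factors, and the prime [q] contains the
    value of one of them. *)
Lemma residue_field b : exists c : k, q (b - c%:A).
Proof.
have [qI q1 qP] := q_prime; have [q0 qD qM] := qI.
have [P Pmonic Pb] := normalization_integral b.
have /choice [c cP] : forall a : A, exists c : k, max_ideal (a - c%:A) := rclr_closed hA.
pose p := \poly_(i < size P) c P`_i.
have p_neq0 : p != 0.
  apply/eqP => /polyP /(_ (size P).-1).
  have size_gt0 : (0 < size P)%N by rewrite size_poly_gt0 monic_neq0.
  rewrite coef0 coef_poly prednK // leqnn -lead_coefE (eqP Pmonic) => c0.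
  have := cP 1; rewrite c0 scale0r subr0.
  by have [_ m1 _] := max_ideal_prime => /m1.
have qp : q (horner_alg b p).
  have -> : horner_alg b p = - ((map_poly nu P).[b] - horner_alg b p).
    by rewrite (eqP Pb) sub0r opprK.
  rewrite -mulN1r; apply: (qM).
  have -> : (map_poly nu P).[b] - horner_alg b p =
      \sum_(i < size P) nu (P`_i - (c P`_i)%:A) * b ^+ i.
    rewrite /horner_alg /horner_morph.
    rewrite (@horner_coef_wide _ (size P) (map_poly nu P)); last exact: size_poly.
    rewrite (@horner_coef_wide _ (size P) (map_poly _ p)); last first.
      exact: leq_trans (size_poly _ _) (size_poly _ _).
    rewrite -sumrB; apply: eq_bigr => i _; rewrite !coef_map coef_poly ltn_ord.
    by rewrite rmorphB mulrBl /= rmorph_alg.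
  apply: is_ideal_sum => // i _; rewrite mulrC; apply: (qM); apply/q_over; exact: cP.
have [rs pE] := closed_field_poly_normal p.
move: qp; rewrite pE linearZ /= mulr_algl => qp.
have lead_neq0 : lead_coef p != 0 by rewrite lead_coef_eq0.
have : q (horner_alg b (\prod_(z <- rs) ('X - z%:P))).
  by rewrite -[horner_alg b _](scalerK lead_neq0) -[_^-1 *: _]mulr_algl; apply: (qM).
rewrite rmorph_prod => /(prime_ideal_prod q_prime) [z].
by rewrite rmorphB /= horner_algX horner_algC; exists z.
Qed.

End OverPrime.
End Normalization.

(** * Local expansions of differentials *)


Section TaylorMorphism.
Variables (k : fieldType) (B : comAlgType k) (m : B -> Prop) (t : B).

(** The proof of [uniformized] is kept as an argument so that the ring morphism structure can be
    attached. *)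
Definition taylor_map of uniformized m t : B -> power_series k := taylor m t.

Variable mt : uniformized m t.
HB.instance Definition _ := GRing.isZmodMorphism.Build B (power_series k)
  (taylor_map mt) (taylor_is_zmod_morphism mt).
HB.instance Definition _ := GRing.isMonoidMorphism.Build B (power_series k)
  (taylor_map mt) (taylor_is_monoid_morphism mt).

Lemma taylor_map_t : taylor_map mt t = psX k. Proof. exact: taylor_t. Qed.
Lemma taylor_map_scalar c : taylor_map mt c%:A = ps_const c. Proof. exact: taylor_scalar. Qed.
Lemma taylor_map0P b : taylor_map mt b 0%N = 0 <-> m b. Proof. exact: taylor0P. Qed.
Lemma taylor_map_neq0 b : ~ m b -> taylor_map mt b 0%N != 0.
Proof. by move=> Nb; apply/eqP => /taylor_map0P. Qed.

Lemma taylor_map_order b : taylor_map mt b != 0 ->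
  exists n s u, [/\ ~ m s, ~ m u & s * b = u * t ^+ n].
Proof.
move=> /ps_order [n [g [bE g0]]]; have [s [u [Ns sb Nu]]] := taylor_lift mt bE.
by exists n, s, u; split=> //; apply: Nu.
Qed.
End TaylorMorphism.

Section Curve.
Variables (k : closedFieldType) (A : comUnitAlgType k) (B : comAlgType k) (K : comUnitAlgType k).
Variables (nu : {lrmorphism A -> B}) (iB : {lrmorphism B -> K}).
Variables (M : lmodType K) (d : K -> M).
Variables (P : finType) (pt : P -> B -> Prop) (t : P -> B) (D : P -> nat).
Hypothesis hA : reduced_curve_local_ring A.
Hypothesis hnu : is_normalization nu iB.
Hypothesis hd : is_kaehler d.
Hypothesis hpt : is_fiber nu pt.
Hypothesis ht : forall p, uniformizer iB pt p (t p).
Hypothesis hD : dominates_conductor nu pt t D.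

Let iB_inj : injective iB := nrm_inj hnu.

Lemma unit_nonzerodivisor s x : iB s \is a GRing.unit -> s * x = 0 -> x = 0.
Proof.
move=> Us /(congr1 iB); rewrite rmorphM rmorph0 => sx0; apply: iB_inj.
by rewrite rmorph0 -[iB x](mulKr Us) sx0 mulr0.
Qed.

Lemma fiber_uniformized p : uniformized (pt p) (t p).
Proof.
have [tp Ut tgen] := ht p; split=> //; first exact: fib_prime hpt p.
- by move=> b; have := residue_field hA hnu (fib_prime hpt p) (fib_over hpt p) b.
- by move=> x; apply: unit_nonzerodivisor.
Qed.

Local Notation T p := (taylor_map (fiber_uniformized p)).

(** The extra factor [t p] forces the element into the maximal ideal even if [D p = 0]. It stays in
    the conductor, which is stable under multiplication by [B]. *)
Lemma conductor_nonunit p : exists f, [/\ conductor nu f, max_ideal f & T p (nu f) != 0].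
Proof.
have [s [f [Ns cf fE]]] := hD p; have [g gE] := cf (t p).
exists g; split.
- by move=> b; have [a aE] := cf (t p * b); exists a; rewrite aE gE mulrA.
- apply/(fib_over hpt p); rewrite gE mulrC [t p * _]mulrC.
  have [[_ _ qM] _ _] := fib_prime hpt p; apply: qM.
  by have [] := ht p.
- rewrite gE fE !rmorphM rmorphXn /= taylor_map_t -mulrA -exprSr mulf_neq0 //.
    by apply: contraTneq (taylor_map_neq0 (fiber_uniformized p) Ns) => ->; rewrite ps0 eqxx.
  by rewrite expf_neq0 // psX_neq0.
Qed.

(** Substitute for Krull's intersection theorem. The elements of [A] with zero expansion form a
    prime [Q] that is minimal by dimension one, so each of them is killed by some [y] outside [Q].
    For [b] in [B], a conductor element [f] brings [f b] into [Q], so [f y b = 0]; as [f y] has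
    nonzero expansion, it is a local unit times a power of [t p], which cancels. *)
Lemma taylor_kernel p b : T p b = 0 -> exists2 u, ~ pt p u & u * b = 0.
Proof.
move=> Tb0; have mt := fiber_uniformized p.
pose Q a := T p (nu a) = 0.
have Qprime : is_prime_ideal Q.
  split; first split; rewrite /Q.
  - by rewrite !rmorph0.
  - by move=> x y Tx Ty; rewrite !rmorphD /= Tx Ty addr0.
  - by move=> r x Tx; rewrite !rmorphM /= Tx mulr0.
  - by rewrite !rmorph1; apply/eqP; rewrite oner_eq0.
  - by move=> x y /eqP; rewrite !rmorphM mulf_eq0 => /orP [/eqP|/eqP]; [left|right].
have [f [cf mf Tf]] := conductor_nonunit p.
have Qmin q' : is_prime_ideal q' -> ~ strict_sub q' Q.
  move=> q'prime q'Q; have [_ [/=]] := rclr_dim1 hA.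
  (* The chain [q'], [Q], maximal ideal would have length 2. *)
  exists (fun i => if i is j.+1 then if j is 0%N then Q else @max_ideal k A else q').
  split=> [[|[|i]] // _|[|[|i]] // _]; first exact: max_ideal_prime hA.
  split; last by exists f => //; apply/eqP.
  move=> a Qa; apply/(fib_over hpt p); apply/(taylor_map0P mt).
  by rewrite (_ : taylor_map mt _ = 0).
have [a aE] := cf b.
have Qa : Q a by rewrite /Q aE rmorphM /= Tb0 mulr0.
have [y Ny ay0] := minimal_prime_killed (rclr_reduced hA) Qprime Qmin Qa.
have Tfy : T p (nu f * nu y) != 0 by rewrite rmorphM mulf_neq0 //; apply/eqP.
have [n [s [u [Ns Nu sfy]]]] := taylor_map_order Tfy.
exists u => //; apply: (unif_powK mt (n := n)); rewrite mulr0.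
rewrite mulrA [_ * u]mulrC -sfy -mulrA -mulrA [nu y * b]mulrC [nu f * _]mulrA -aE -rmorphM ay0.
by rewrite rmorph0 mulr0.
Qed.

Lemma taylor_unit_neq0 p b : iB b \is a GRing.unit -> T p b != 0.
Proof.
move=> Ub; apply/eqP => /taylor_kernel [u Nu]; rewrite mulrC => /(unit_nonzerodivisor Ub) u0.
by apply: Nu; rewrite u0; have [[]] := fib_prime hpt p.
Qed.

Lemma fraction_denominator z : exists b c, iB c \is a GRing.unit /\ iB c * z = iB b.
Proof.
have [_ Uden /(_ z) [a [s [nzd_s ->]]]] := nrm_fractions hnu.
by exists (nu a), (nu s); split; [exact: Uden|rewrite mulrC divrK //; exact: Uden].
Qed.

Local Notation "x %:L" := (@FracField.tofrac (power_series k) x) (at level 2, format "x %:L").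

(** Such a [phi] sends a differential to its quotient by [dt_p], expanded in k((X)). *)
Record expansion p (phi : M -> {fraction (power_series k)}) : Prop := Expansion {
  expansionD : forall x y, phi (x + y) = phi x + phi y;
  expansionZ : forall b x, phi (iB b *: x) = (T p b)%:L * phi x;
  expansion_d : forall b, phi (d (iB b)) = (ps_deriv (T p b))%:L
}.

Lemma expansion_exists p : exists phi, expansion p phi.
Proof.
pose T' : {rmorphism B -> {fraction (power_series k)}} := @FracField.tofrac (power_series k) \o T p.
pose D' b := (ps_deriv (T p b))%:L.
have D'D x y : D' (x + y) = D' x + D' y by rewrite /D' rmorphD ps_derivD tofracD.
have D'M x y : D' (x * y) = T' x * D' y + T' y * D' x.
  by rewrite /D' rmorphM ps_derivM tofracD !tofracM /= addrC [X in _ + X]mulrC.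
have frac z : exists b c, T' c != 0 /\ iB c * z = iB b.
  have [b [c [Uc cz]]] := fraction_denominator z; exists b, c; split=> //.
  by rewrite /= tofrac_eq0 taylor_unit_neq0.
have [L [E [LB EB ED EM]]] := extend_derivation iB_inj D'D D'M frac.
have Ec (c : k) : E c%:A = 0.
  by rewrite -(rmorph_alg iB) EB /D' taylor_map_scalar ps_deriv_const tofrac0.
have [phi [phiD phiZ phid]] := kaehler_lift hd ED Ec EM.
exists phi; split=> // [b x|b]; first by rewrite phiZ LB.
by rewrite phid EB.
Qed.

Local Notation reg := (regular_at iB d pt).
Local Notation polar := (polar_part iB d t).
Local Notation resid := (residue iB d pt t).

Lemma regular_diffD x y : regular_diff iB d x -> regular_diff iB d y -> regular_diff iB d (x + y).
Proof. by move=> [s ->] [s' ->]; exists (s ++ s'); rewrite big_cat. Qed.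

Lemma regular_diffZ b x : regular_diff iB d x -> regular_diff iB d (iB b *: x).
Proof.
move=> [s ->]; exists [seq (b * bc.1, bc.2) | bc <- s].
by rewrite big_map scaler_sumr; apply: eq_bigr => bc _; rewrite scalerA rmorphM.
Qed.

Lemma regular_at_exact p b c : reg p (iB b *: d (iB c)).
Proof.
have [_ q1 _] := fib_prime hpt p; exists 1; split=> //.
by exists [:: (b, c)]; rewrite big_seq1 rmorph1 scale1r.
Qed.

Lemma regular_atD p x y : reg p x -> reg p y -> reg p (x + y).
Proof.
move=> [s [Ns sx]] [s' [Ns' sy]]; exists (s * s').
split; first exact: unif_notM (fiber_uniformized p) _ _ Ns Ns'.
rewrite scalerDr; apply: regular_diffD; rewrite rmorphM -scalerA; last exact: regular_diffZ.
by rewrite scalerA mulrC -scalerA; apply: regular_diffZ.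
Qed.

Lemma regular_atZ p b x : reg p x -> reg p (iB b *: x).
Proof.
move=> [s [Ns sx]]; exists s; split=> //.
by rewrite scalerA mulrC -scalerA; apply: regular_diffZ.
Qed.

Lemma regular_at0 p : reg p 0.
Proof. by rewrite -(scale0r (d (iB 0))) -(rmorph0 iB); apply: regular_at_exact. Qed.

Lemma regular_at_local p s x : ~ pt p s -> reg p (iB s *: x) -> reg p x.
Proof.
move=> Ns [s' [Ns' sx]]; exists (s' * s).
split; first exact: unif_notM (fiber_uniformized p) _ _ Ns' Ns.
by rewrite rmorphM -scalerA.
Qed.

Lemma regular_at_sum p (I : Type) (r : seq I) (Q : pred I) (F : I -> M) :
  (forall i, Q i -> reg p (F i)) -> reg p (\sum_(i <- r | Q i) F i).
Proof. by move=> FQ; elim/big_ind: _ => //; [exact: regular_at0|exact: regular_atD]. Qed.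

Let Ut p : iB (t p) \is a GRing.unit. Proof. by have [] := ht p. Qed.

(** * Laurent tails at a point of the fiber *)

Lemma polarD p n (a a' : 'I_n -> k) : polar p (fun j => a j + a' j) = polar p a + polar p a'.
Proof.
rewrite /polar_part -big_split; apply: eq_bigr => j _ /=.
by rewrite scalerDl mulrDl scalerDl.
Qed.

Lemma polarZ p n c (a : 'I_n -> k) : polar p (fun j => c * a j) = iB c%:A *: polar p a.
Proof.
rewrite /polar_part scaler_sumr; apply: eq_bigr => j _ /=.
have -> : (c * a j)%:A = c%:A * (a j)%:A :> K by rewrite -scalerAl mul1r scalerA.
by rewrite rmorph_alg scalerA mulrA.
Qed.

Lemma polar_delta p n (j : 'I_n) c :
  polar p (fun i => if i == j then c else 0) = (c%:A / iB (t p) ^+ j.+1) *: d (iB (t p)).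
Proof.
rewrite /polar_part (bigD1 j) //= eqxx big1 ?addr0 // => i /negPf ->.
by rewrite scale0r mul0r scale0r.
Qed.

(** On a differential without a Laurent tail, [residue] defaults to 0; its linearity is therefore
    proved for tailed differentials only. *)
Definition tailed p n eta := exists a : 'I_n -> k, reg p (eta - polar p a).

Lemma tailedD p n x y : tailed p n x -> tailed p n y -> tailed p n (x + y).
Proof.
move=> [a xa] [b yb]; exists (fun j => a j + b j).
by rewrite polarD opprD addrACA; apply: regular_atD.
Qed.

Lemma tailed_regular p n x : reg p x -> tailed p n x.
Proof.
move=> rx; exists (fun _ => 0); rewrite /polar_part big1 ?subr0 // => j _.
by rewrite scale0r mul0r scale0r.
Qed.

Lemma tailed_monomial p n c j : (j < n)%N ->
  tailed p n ((c%:A / iB (t p) ^+ j.+1) *: d (iB (t p))).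
Proof.
move=> lt_jn; exists (fun i => if i == Ordinal lt_jn then c else 0).
by rewrite polar_delta subrr; apply: regular_at0.
Qed.

Lemma tailed_sum p n (I : Type) (r : seq I) (Q : pred I) (F : I -> M) :
  (forall i, Q i -> tailed p n (F i)) -> tailed p n (\sum_(i <- r | Q i) F i).
Proof.
move=> FQ; elim/big_ind: _ => //; last exact: tailedD.
by apply: tailed_regular; apply: regular_at0.
Qed.

Lemma tailed_le p n n' x : (n <= n')%N -> tailed p n x -> tailed p n' x.
Proof.
move=> le_n [a xa]; rewrite -(subrK (polar p a) x).
apply: tailedD; first exact: tailed_regular.
by apply: tailed_sum => j _; apply: tailed_monomial; apply: leq_trans le_n.
Qed.

Lemma tailed_scalar p n c x : tailed p n x -> tailed p n (iB c%:A *: x).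
Proof.
move=> [a xa]; exists (fun j => c * a j).
by rewrite polarZ -scalerBr; apply: regular_atZ.
Qed.

Lemma tailed_t p n x : tailed p n x -> tailed p n (iB (t p) *: x).
Proof.
move=> [a xa]; rewrite -(subrK (polar p a) x) scalerDr.
apply: tailedD; first by apply: tailed_regular; apply: regular_atZ.
rewrite scaler_sumr; apply: tailed_sum => j _; rewrite scalerA mulrCA exprS.
rewrite invrM ?unitrX // [iB _ * (_ / _)]mulrCA divrr // mulr1.
case: j => -[|j] lt_jn /=; last by apply: tailed_monomial; apply: ltnW.
rewrite invr1 mulr1 -(rmorph_alg iB); apply: tailed_regular.
exact: regular_at_exact.
Qed.

Lemma regular_tn_polar p n (a : 'I_n -> k) : reg p (iB (t p ^+ n) *: polar p a).
Proof.
rewrite scaler_sumr; apply: regular_at_sum => j _.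
have le_jn := ltn_ord j.
rewrite scalerA -{1}(subnK le_jn) exprD rmorphM !rmorphXn /= mulrCA.
rewrite mulrK ?unitrX // -(rmorph_alg iB) -rmorphXn -rmorphM.
exact: regular_at_exact.
Qed.

(** Split [b] into a polynomial in [t p], which acts by shifting and scaling tails, and a remainder
    locally divisible by [t p ^+ n], which clears the pole. *)
Lemma tailedZ p n b x : tailed p n x -> tailed p n (iB b *: x).
Proof.
move=> xn; have mt := fiber_uniformized p.
have [q [s [r [Ns sb]]]] := taylor_poly_exists mt n b.
rewrite -(subrK (horner_alg (t p) q) b) rmorphD scalerDl.
apply: tailedD; last first.
  elim/poly_ind: q {sb} => [|q c IH].
    by rewrite !rmorph0 scale0r; apply/tailed_regular/regular_at0.
  rewrite !rmorphD !rmorphM /= horner_algX horner_algC scalerDl.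
  apply: tailedD; last exact: tailed_scalar.
  by rewrite mulrC -scalerA; apply: tailed_t.
have [a xa] := xn; rewrite -(subrK (polar p a) x) scalerDr.
apply: tailedD; first by apply: tailed_regular; apply: regular_atZ.
apply: tailed_regular; apply: (regular_at_local Ns).
by rewrite scalerA -rmorphM sb rmorphM -scalerA; apply: regular_atZ; apply: regular_tn_polar.
Qed.

Section Expansion.
Variables (p : P) (phi : M -> {fraction (power_series k)}).
Hypothesis phiP : expansion p phi.

Lemma expansion_regular x : reg p x -> exists w, phi x = w%:L.
Proof.
have [phiD phiZ phid] := phiP; move=> [s [Ns [bs sx]]].
have phi0 : phi 0 = 0 by have /eqP := phiD 0 0; rewrite addr0 -subr_eq subrr eq_sym => /eqP.
have [w sw] : exists w, phi (iB s *: x) = w%:L.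
  rewrite sx {sx}; elim: bs => [|bc bs [w IH]]; first by exists 0; rewrite big_nil phi0 tofrac0.
  rewrite big_cons phiD IH phiZ phid -tofracM -tofracD; by eexists.
have [g gs] := ps_inverse (taylor_map_neq0 (fiber_uniformized p) Ns).
by exists (g * w); rewrite tofracM -sw phiZ mulrA -tofracM gs tofrac1 mul1r.
Qed.

Lemma expansion_sum (I : Type) (r : seq I) (Q : pred I) (F : I -> M) :
  phi (\sum_(i <- r | Q i) F i) = \sum_(i <- r | Q i) phi (F i).
Proof.
have [phiD _ _] := phiP.
have phi0 : phi 0 = 0 by have /eqP := phiD 0 0; rewrite addr0 -subr_eq subrr eq_sym => /eqP.
by apply: (big_morph phi).
Qed.

Lemma expansion_monomial c j :
  phi ((c%:A / iB (t p) ^+ j.+1) *: d (iB (t p))) = (ps_const c)%:L / (psX k)%:L ^+ j.+1.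
Proof.
have [_ phiZ phid] := phiP.
have X0 : (psX k)%:L ^+ j.+1 != 0 by rewrite expf_neq0 // tofrac_eq0 psX_neq0.
apply: (mulIf X0); rewrite divfK // mulrC -tofracXn -(taylor_map_t (fiber_uniformized p)) -rmorphXn.
rewrite -phiZ scalerA rmorphXn mulrC divrK ?unitrX // -(rmorph_alg iB) phiZ.
by rewrite taylor_map_scalar phid taylor_map_t ps_deriv_psX tofrac1 mulr1.
Qed.

(** The test series [g] makes every coefficient of the tail readable: [g = 1] gives the residue, and
    [g = psX k ^+ j] gives [a j]. *)
Lemma expansion_polar n (a : 'I_n -> k) (g : power_series k) :
  is_laurent_residue (g%:L * phi (polar p a)) (\sum_(j < n) a j * g j).
Proof.
rewrite expansion_sum mulr_sumr.
elim/big_ind2: _ => [|x c y c'|j _].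
- by rewrite -(tofrac0 (power_series k)); apply: laurent_residue_integral.
- exact: laurent_residueD.
rewrite expansion_monomial mulrA -tofracM -ps_constM.
by rewrite [g * _]mulrC; apply: laurent_residue_pole.
Qed.

Lemma expansion_residue x c : is_residue iB d pt t p x c -> is_laurent_residue (phi x) c.
Proof.
have [phiD _ _] := phiP.
move=> [n [a [/expansion_regular [w xw] <-]]].
rewrite -(subrK (polar p a) x) phiD xw -[a ord0]add0r.
apply: laurent_residueD; first exact: laurent_residue_integral.
have := expansion_polar a 1; rewrite tofrac1 mul1r big_ord_recl mulr1 big1 ?addr0 // => i _.
by rewrite mulr0.
Qed.

Lemma tailed_residue n x : tailed p n x -> is_laurent_residue (phi x) (resid p x).
Proof.
(* The tail is lengthened by one because [is_residue] reads entry [ord0], which requires a nonempty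
   tail. *)
move=> /(tailed_le (leqnSn n)) [a xa]; apply: expansion_residue.
by apply: xgetPex; exists (a ord0), n, a.
Qed.

(** Converse of [expansion_regular] for tailed differentials: multiplying the polar part, whose
    expansion is integral, by powers of the variable shows that all its coefficients vanish. *)
Lemma tailed_integral_regular n x w : tailed p n x -> phi x = w%:L -> reg p x.
Proof.
have [phiD _ _] := phiP.
move=> [a xa] xw; have [w' xw'] := expansion_regular xa.
have polarE : phi (polar p a) = (w - w')%:L.
  by rewrite tofracB -xw -xw' -{1}(subrK (polar p a) x) phiD addrC addKr.
suff a0 j : a j = 0.
  move: xa; rewrite /polar_part big1 ?subr0 // => j _.
  by rewrite a0 scale0r mul0r scale0r.
have := expansion_polar a (psX k ^+ j); rewrite polarE -tofracM.
move=> /laurent_residue_uniq /(_ (laurent_residue_integral _)) <-.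
rewrite (bigD1 j) //= big1 ?addr0 => [|i ij]; rewrite psXnE.
  by rewrite eqxx mulr1.
by rewrite -val_eqE in ij; rewrite (negPf ij) mulr0.
Qed.
End Expansion.

Lemma residue_regular p x : reg p x -> resid p x = 0.
Proof.
move=> rx; have [phi phiP] := expansion_exists p.
have [w xw] := expansion_regular phiP rx.
have := (tailed_residue phiP (tailed_regular 0 rx)); rewrite xw.
by move/laurent_residue_uniq; apply; apply: laurent_residue_integral.
Qed.

Lemma residueD p n x y : tailed p n x -> tailed p n y ->
  resid p (x + y) = resid p x + resid p y.
Proof.
move=> xn yn; have [phi phiP] := expansion_exists p.
apply: laurent_residue_uniq (tailed_residue phiP (tailedD xn yn)) _.
rewrite (expansionD phiP); apply: laurent_residueD.
  exact: (tailed_residue phiP xn).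
exact: (tailed_residue phiP yn).
Qed.

Lemma residueZ p n c x : tailed p n x -> resid p (iB c%:A *: x) = c * resid p x.
Proof.
move=> xn; have [phi phiP] := expansion_exists p.
apply: laurent_residue_uniq (tailed_residue phiP (tailed_scalar c xn)) _.
rewrite (expansionZ phiP) taylor_map_scalar; apply: laurent_residueZ.
exact: (tailed_residue phiP xn).
Qed.

Lemma regular_at_psXn p n b g x : T p b = psX k ^+ n * g -> tailed p n x ->
  reg p (iB b *: x).
Proof.
move=> bE [a xa]; have [s [r [Ns sb _]]] := taylor_lift (fiber_uniformized p) bE.
apply: (regular_at_local Ns); rewrite scalerA -rmorphM sb rmorphM -scalerA.
apply: regular_atZ; rewrite -(subrK (polar p a) x) scalerDr; apply: regular_atD.
  exact: regular_atZ.
exact: regular_tn_polar.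
Qed.

(** * Approximation at several points *)

Lemma taylor_vanish p b : pt p b -> exists g, T p b = psX k * g.
Proof.
move=> pb; have [|g] := @psXn_divides _ (T p b) 1; last by rewrite expr1; exists g.
by case=> // _; apply/taylor_map0P.
Qed.

(** Primes with residue field [k] are maximal, so distinct ones are incomparable; an element of one
    outside the other is rescaled to have value 1 there. *)
Lemma separate_points p p' : p' != p -> exists e, pt p' e /\ pt p (e - 1).
Proof.
move=> p'p; have mt := fiber_uniformized p; have mt' := fiber_uniformized p'.
have [x p'x Npx] : exists2 x, pt p' x & ~ pt p x.
  apply: contrapT => N; have sub x : pt p' x -> pt p x.
    by move=> p'x; apply: contrapT => Npx; apply: N; exists x.
  case/eqP: p'p; apply: fib_inj hpt _ _ _ => b; split; first exact: sub.
  move=> pb; have [c p'b] := unif_residue mt' b.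
  suff c0 : c = 0 by rewrite c0 scale0r subr0 in p'b.
  apply: (unif_scalar mt); rewrite -[c%:A](subKr b).
  have [[_ qD qM] _ _] := fib_prime hpt p.
  by rewrite -mulN1r; apply: (qD) => //; apply: (qM); apply: sub.
have [c pc] := unif_residue mt x.
have c0 : c != 0 by apply: contra_notN Npx => /eqP c0; rewrite c0 scale0r subr0 in pc.
have [[_ _ qM] _ _] := fib_prime hpt p; have [[_ _ qM'] _ _] := fib_prime hpt p'.
exists (c^-1%:A * x); split; first exact: qM'.
have -> : c^-1%:A * x - 1 = c^-1%:A * (x - c%:A).
  by rewrite mulrBr; congr (_ - _); rewrite -scalerAl mul1r scalerA mulVf ?scale1r.
exact: qM.
Qed.

Lemma separating_function p n : exists e, (exists g, T p (e - 1) = psX k ^+ n * g) /\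
  forall p', p' != p -> exists g, T p' e = psX k ^+ n * g.
Proof.
have /choice [e' e'P] : forall p', exists e, p' != p -> pt p' e /\ pt p (e - 1).
  move=> p'; have [->|/separate_points [e eP]] := eqVneq p' p; first by exists 0.
  by exists e.
pose e0 := \prod_(p' | p' != p) e' p'.
have e0p' p' : p' != p -> pt p' e0.
  move=> p'p; rewrite /e0 (bigD1 p') //= mulrC.
  by have [[_ _ qM] _ _] := fib_prime hpt p'; apply: qM; have [] := e'P p' p'p.
have e0p : T p e0 0%N = 1.
  apply: (big_ind (fun x => T p x 0%N = 1)) => [|x y xE yE|p' /e'P [_ pe]].
  - by rewrite rmorph1.
  - by rewrite rmorphM psM0 [_ x _]xE [_ y _]yE mulr1.
  move/(taylor_map0P (fiber_uniformized p)): pe; rewrite rmorphB rmorph1.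
  by rewrite psD psN => /eqP; rewrite subr_eq0 => /eqP.
(* At [p] the value of [e0] is 1, so [1 - e0 ^+ n] vanishes and its power vanishes to order [n].
   Elsewhere [e0] vanishes, and [e0 ^+ n] divides the whole expression. *)
exists (1 - (1 - e0 ^+ n) ^+ n); split.
  have [|g gE] := @taylor_vanish p (1 - e0 ^+ n).
    apply/(taylor_map0P (fiber_uniformized p)).
    by rewrite rmorphB rmorph1 rmorphXn /= psD psN psX0 e0p expr1n subrr.
  exists (- g ^+ n); rewrite [_ - 1]addrC addKr rmorphN rmorphXn /= gE exprMn.
  by rewrite mulrN.
move=> p' /e0p' /taylor_vanish [g gE].
exists (g ^+ n * \sum_(i < n) T p' (1 - e0 ^+ n) ^+ i).
rewrite -opprB subrX1 -mulNr opprB subKr rmorphM rmorphXn /= gE exprMn -mulrA.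
by rewrite rmorph_sum; congr (_ * (_ * _)); apply: eq_bigr => i _; rewrite rmorphXn.
Qed.

(* If [x] has a pole of order [m + 1] at [p], then multiplying it by a function
   that looks like [t_p ^ m] at [p] and vanishes to high order at the other
   points leaves a single nonzero residue. *)
Lemma residue_nondegenerate n x : (forall p, tailed p n x) ->
  (forall b, \sum_p resid p (iB b *: x) = 0) -> forall p, reg p x.
Proof.
move=> xn sum0 p; have [phi phiP] := expansion_exists p.
(* The least such [m] is the pole order of [x] at [p]. *)
pose Q m := `[< exists w, phi x * (psX k)%:L ^+ m = w%:L >].
have exQ : exists m, Q m.
  have [m [w [xw _]]] := tailed_residue phiP (xn p).
  by exists m.+1; apply/asboolP; exists w.
case: (ex_minnP exQ) => -[|m] /asboolP [w xw] m_min.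
  by apply: (tailed_integral_regular phiP (xn p) (w := w)); rewrite -xw mulr1.
exfalso; have w0 : w 0%N != 0.
  apply/eqP => w0; have [|g gE] := @psXn_divides _ w 1; first by case.
  suff /m_min : Q m by rewrite ltnn.
  apply/asboolP; exists g.
  have X0 : (psX k)%:L != 0 by rewrite tofrac_eq0 psX_neq0.
  by apply: (mulIf X0); rewrite -mulrA -exprSr xw gE expr1 tofracM mulrC.
(* Order [n] suffices to clear the poles at the other points; the extra one ensures that [e] has
   value 1 at [p] also for [n = 0]. *)
have [e [[g eE] eE']] := separating_function p n.+1.
have := sum0 (e * t p ^+ m); rewrite (bigD1 p) //= big1 ?addr0 => [|p' /eE' [g' e'E]].
  have := tailed_residue phiP (tailedZ (e * t p ^+ m) (xn p)).
  set c := resid _ _ => res_c c0; case/eqP: w0; rewrite -c0.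
  apply: laurent_residue_uniq res_c; exists 0%N, (T p e * w); split.
    rewrite (expansionZ phiP) rmorphM rmorphXn /= taylor_map_t tofracM tofracM -xw.
    by rewrite tofracXn expr1 exprSr -!mulrA; congr (_ * _); rewrite mulrCA.
  rewrite psM0; have -> : e = (e - 1) + 1 by rewrite subrK.
  by rewrite rmorphD rmorph1 /= eE psD psXnM_low // add0r mul1r.
apply: residue_regular; rewrite mulrC rmorphM -scalerA; apply: regular_atZ.
apply: (@regular_at_psXn p' n _ (psX k * g')) => //.
by rewrite e'E exprSr mulrA.
Qed.

(** * Principal parts and the two subspaces *)

Local Notation has_pp := (has_principal_part iB d pt t).
Local Notation omega := (dualizing nu iB d pt t).
Let V := principal_parts k D.
Let comp (v : V) p (j : 'I_(D p)) : k := v (Tagged (fun q => 'I_(D q)) j).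

(** The sum of all bounds serves as one tail length valid at every point, as [residue_nondegenerate]
    requires. *)
Lemma principal_part_tailed x (v : V) : has_pp x v -> forall p, tailed p (\sum_q D q) x.
Proof.
move=> xv p; apply: (@tailed_le p (D p)); last by exists (@comp v p); apply: xv.
by rewrite (bigD1 p) //= leq_addr.
Qed.

Lemma principal_partD x y (v w : V) : has_pp x v -> has_pp y w -> has_pp (x + y) (v + w).
Proof.
move=> xv yw p; set a := (fun j => _).
have -> : a = fun j => comp v j + comp w j by apply/funext => j; rewrite /a ffunE.
by rewrite polarD opprD addrACA; apply: regular_atD; [apply: xv|apply: yw].
Qed.

Lemma principal_partZ c x (v : V) : has_pp x v -> has_pp (iB c%:A *: x) (c *: v).
Proof.
move=> xv p; set a := (fun j => _).
have -> : a = fun j => c * comp v j by apply/funext => j; rewrite /a ffunE.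
by rewrite polarZ -scalerBr; apply: regular_atZ; apply: xv.
Qed.

Lemma principal_part0 : has_pp 0 (0 : V).
Proof.
move=> p; rewrite /polar_part big1 ?subr0; first exact: regular_at0.
by move=> j _; rewrite ffunE scale0r mul0r scale0r.
Qed.

(** The residue depends on the principal part alone. Pairing with the series 1 selects the
    coefficient of index 0 and gives 0 when [D p = 0]. *)
Lemma principal_part_residue x (v : V) p : has_pp x v ->
  resid p x = \sum_(j < D p) comp v j * (1 : power_series k) j.
Proof.
move=> xv; have [phi phiP] := expansion_exists p.
apply: laurent_residue_uniq (tailed_residue phiP (principal_part_tailed xv p)) _.
have [w xw] := expansion_regular phiP (xv p).
rewrite -(subrK (polar p (@comp v p)) x) (expansionD phiP) xw -[\sum_(j < _) _]add0r.
apply: laurent_residueD; first exact: laurent_residue_integral.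
by rewrite -[phi _]mul1r -(tofrac1 (power_series k)); apply: expansion_polar.
Qed.

Lemma descends_submodule : is_submodule (descends nu iB d pt t (D := D)).
Proof.
split=> [|v w [x xv xo] [y yw yo]|c v [x xv xo]].
- exists 0; first exact: principal_part0.
  by move=> f; apply: big1 => p _; rewrite scaler0; apply/residue_regular/regular_at0.
- exists (x + y); first exact: principal_partD.
  move=> f; apply: (etrans _ (etrans (congr2 +%R (xo f) (yo f)) (addr0 0))).
  rewrite -big_split.
  apply: eq_bigr => p _ /=.
  rewrite scalerDr; apply: residueD; apply: tailedZ; apply: principal_part_tailed; eassumption.
- exists (iB c%:A *: x); first exact: principal_partZ.
  move=> f; apply: (etrans _ (etrans (congr1 ( *%R c) (xo f)) (mulr0 c))).
  rewrite mulr_sumr.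
  apply: eq_bigr => p _ /=.
  rewrite scalerA mulrC -scalerA; apply: residueZ; apply: tailedZ.
  exact: (principal_part_tailed xv p).
Qed.

Lemma conductor_annihilated_submodule :
  is_submodule (conductor_annihilated nu iB d pt t (D := D)).
Proof.
split=> [|v w [x xv xc] [y yw yc]|c v [x xv xc]].
- exists 0; first exact: principal_part0.
  by move=> f _ p; rewrite scaler0; apply: regular_at0.
- exists (x + y); first exact: principal_partD.
  by move=> f cf p; rewrite scalerDr; apply: regular_atD; [apply: xc|apply: yc].
- exists (iB c%:A *: x); first exact: principal_partZ.
  by move=> f cf p; rewrite scalerA mulrC -scalerA; apply: regular_atZ; apply: xc.
Qed.

Lemma descends_annihilated (v : V) : descends nu iB d pt t v ->
  conductor_annihilated nu iB d pt t v.
Proof.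
move=> [x xv xo]; exists x => // f cf.
apply: (@residue_nondegenerate (\sum_q D q)).
  by move=> p; apply: tailedZ; apply: (principal_part_tailed xv p).
move=> b; have [a aE] := cf b; apply: etrans (xo a); apply: eq_bigr => p _.
by rewrite scalerA -rmorphM /iA aE mulrC.
Qed.

Lemma fiber_nonempty : exists p : P, True.
Proof.
have [q qprime qover] := lying_over hA hnu.
by have [p _] := fib_all hpt qprime qover; exists p.
Qed.

Definition simple_pole p := (1%:A / iB (t p) ^+ 1) *: d (iB (t p)).

Lemma simple_pole_tailed p : tailed p 1 (simple_pole p).
Proof. exact: tailed_monomial. Qed.

Lemma residue_simple_pole p : resid p (simple_pole p) = 1.
Proof.
have [phi phiP] := expansion_exists p.
apply: laurent_residue_uniq (tailed_residue phiP (simple_pole_tailed p)) _.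
rewrite /simple_pole (expansion_monomial phiP 1 0).
exact: (laurent_residue_pole (ps_const 1) 0).
Qed.

(** The form [dt_p / t_p] may have poles at other points, because [t p] may vanish there; a
    separating function absorbs these zeros. *)
Lemma simple_pole_exists p : exists x,
  reg p (x - simple_pole p) /\ forall p', p' != p -> reg p' x.
Proof.
have /choice [n /choice [s /choice [u sE]]] : forall p', exists n s u,
    [/\ ~ pt p' s, ~ pt p' u & s * t p = u * t p' ^+ n].
  by move=> p'; apply: (taylor_map_order (mt := fiber_uniformized p')); apply: taylor_unit_neq0.
(* The sum dominates the order [n p'] of [t p] at each point; the extra one makes [e - 1] vanish at
   [p], which cancels the simple pole in the difference. *)
have [e [[g eE] eE']] := separating_function p (\sum_p' n p').+1.
exists (iB e *: simple_pole p); split.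
  rewrite -[X in _ - X]scale1r -scalerBl -(rmorph1 iB) -rmorphB.
  apply: (@regular_at_psXn p 1 _ (psX k ^+ (\sum_p' n p') * g)); last exact: simple_pole_tailed.
  by rewrite eE exprS expr1 mulrA.
move=> p' p'p; have [g' e'E] := eE' p' p'p.
have [s' [r [Ns' s'e _]]] := taylor_lift (fiber_uniformized p') e'E.
have [Ns Nu su] := sE p'.
apply: (@regular_at_local _ (u p' * s')).
  exact: unif_notM (fiber_uniformized p') _ _ Nu Ns'.
have le_n : (n p' <= (\sum_p' n p').+1)%N by rewrite (bigD1 p') //= -addnS leq_addr.
have e_t : u p' * s' * e = r * t p' ^+ ((\sum_p' n p').+1 - n p') * s p' * t p.
  rewrite -mulrA s'e -{1}(subnK le_n) exprD -[in RHS]mulrA su; ring.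
rewrite /simple_pole !scalerA -rmorphM e_t rmorphM scale1r expr1 mul1r mulrK; last exact: Ut.
exact: regular_at_exact.
Qed.

(** * The singular case: the inclusion is strict *)

Section Singular.
Hypothesis conductor_max : forall f, conductor nu f -> max_ideal f.

Lemma bound_gt0 p : (0 < D p)%N.
Proof.
have [s [f [Ns cf fE]]] := hD p; rewrite lt0n; apply: contra_notN Ns => /eqP Dp0.
rewrite Dp0 mulr1 in fE; rewrite -fE.
by apply/(fib_over hpt p); apply: conductor_max.
Qed.

Lemma annihilated_not_descending :
  exists2 v : V, conductor_annihilated nu iB d pt t v & ~ descends nu iB d pt t v.
Proof.
have [p _] := fiber_nonempty; have [x [xp xp']] := simple_pole_exists p.
pose j0 := Ordinal (bound_gt0 p).
pose v : V := [ffun i => (i == Tagged (fun q => 'I_(D q)) j0)%:R].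
have compE (j : 'I_(D p)) : comp v j = if j == j0 then 1 else 0.
  by rewrite /comp ffunE -tag_eqE /tag_eq /= eqxx tagged_asE; case: (j == j0).
have compE' p' (j : 'I_(D p')) : p' != p -> comp v j = 0.
  by move=> p'p; rewrite /comp ffunE -tag_eqE /tag_eq /= (negPf p'p).
have xv : has_pp x v.
  move=> p'; have [->|p'p] := eqVneq p' p.
    have -> : (fun j => v (Tagged (fun q => 'I_(D q)) j)) =
        (fun j : 'I_(D p) => if j == j0 then 1 else 0) by apply/funext => j; apply: compE.
    by rewrite polar_delta.
  rewrite /polar_part big1 ?subr0; first exact: xp'.
  by move=> j _; rewrite [v _]compE' // scale0r mul0r scale0r.
exists v.
  exists x => // f cf p'; have /(fib_over hpt p') /taylor_vanish [g gE] := conductor_max cf.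
  apply: (@regular_at_psXn p' 1 _ g); first by rewrite expr1.
  have [->|p'p] := eqVneq p' p; last by apply: tailed_regular; apply: xp'.
  rewrite -(subrK (simple_pole p) x); apply: tailedD; last exact: simple_pole_tailed.
  exact: tailed_regular.
(* The representative [y] need not be [x], so its residues are computed from [v]. *)
move=> [y yv /(_ 1)]; rewrite (bigD1 p) //= /iA !rmorph1 scale1r big1 => [|p' p'p].
  rewrite addr0 (principal_part_residue p yv) (bigD1 j0) //= compE eqxx mul1r.
  rewrite big1 => [|j jj0]; last by rewrite compE (negPf jj0) mul0r.
  by move/eqP; rewrite addr0 oner_eq0.
rewrite (principal_part_residue p' yv) big1 // => j _.
by rewrite compE' ?mul0r.
Qed.

Lemma delta_deg_gt0 : (0 < delta_deg nu iB d pt t D)%R.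
Proof.
rewrite /delta_deg subr_gt0 ltz_nat; apply: num_constraints_lt.
- exact: descends_submodule.
- exact: conductor_annihilated_submodule.
- exact: descends_annihilated.
- exact: annihilated_not_descending.
Qed.
End Singular.

(** * The case A = B *)

Section Regular.
Hypothesis nu_surj : forall b, exists a, b = nu a.
Variable p0 : P.

Lemma regular_unit b : ~ pt p0 b -> exists c, c * b = 1.
Proof.
have [a ->] := nu_surj b => Nb.
have Ua : a \is a GRing.unit by apply/negPn/negP => /(fib_over hpt p0).
by exists (nu a^-1); rewrite -rmorphM mulVr // rmorph1.
Qed.

Lemma regular_fiber p : p = p0.
Proof.
apply: fib_inj hpt _ _ _ => b; have [a ->] := nu_surj b.
by split=> /(fib_over hpt) /(fib_over hpt).
Qed.

(** This is the discrete valuation ring property: elements outside [pt p0] are now units, so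
    denominators disappear and only 0 has zero expansion. *)
Lemma regular_order b : b = 0 \/ exists n u, (exists u', u' * u = 1) /\ b = u * t p0 ^+ n.
Proof.
have [/eqP Tb0|/taylor_map_order [n [s [u [Ns Nu sb]]]]] := boolP (T p0 b == 0).
  have [u /regular_unit [c cu] ub0] := taylor_kernel Tb0.
  by left; rewrite -[b]mul1r -cu -mulrA ub0 mulr0.
have [[c cs] [c' cu]] := (regular_unit Ns, regular_unit Nu).
right; exists n, (c * u); split; last by rewrite -mulrA -sb mulrA cs mul1r.
by exists (s * c'); rewrite mulrACA cu mulr1 mulrC.
Qed.

Local Notation dt := (d (iB (t p0))).

Let dD x y : d (x + y) = d x + d y. Proof. by have [[]] := hd. Qed.
Let dM x y : d (x * y) = x *: d y + y *: d x. Proof. by have [[]] := hd. Qed.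
Let dc (c : k) : d c%:A = 0.
Proof.
have [[_ dZ _] _] := hd; rewrite dZ; have := dM 1 1.
rewrite mulr1 scale1r => /eqP; rewrite -subr_eq subrr eq_sym => /eqP ->.
exact: scaler0.
Qed.

Let iA' : {rmorphism A -> K} := iB \o nu.
Let N := restrict_scalars M iA'.

(** Nakayama's lemma over [A], for the span of the differentials of the finitely many generators
    [g]; the product and quotient rules put every [d (iA' x)] in that span. *)
Lemma regular_diff_generated a : exists b, d (iA' a) = iB b *: dt.
Proof.
pose S (x : N) := exists b, (x : M) = iB b *: dt.
have S_sub : is_submodule S.
  split=> [|x y [b ->] [c ->]|a' x [b xE]]; first by exists 0; rewrite rmorph0 scale0r.
    by exists (b + c); rewrite rmorphD scalerDl.
  exists (nu a' * b); by rewrite rmorphM -scalerA -xE.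
have [tau tauE] := nu_surj (t p0).
have tau_max : max_ideal tau by apply/(fib_over hpt p0); rewrite -tauE; have [] := ht p0.
have tau_rad a' : 1 - a' * tau \is a GRing.unit.
  have [|//] := rclr_local hA (a' * tau).
  by rewrite unitrM (negPf tau_max) andbF.
have [g gP] := rclr_eft hA.
pose s : seq N := [seq d (iA' x) | x <- g].
have NZ (a' : A) (x : N) : a' *: x = iA' a' *: (x : M) by [].
have [sp0 spD spZ] := span_over_sub S_sub s.
have span_gen x : generated_subalgebra g x -> span_over S s (d (iA' x)).
  elim=> [c|y gy|y z _ IHy _ IHz|y z _ IHy _ IHz].
  - have -> : iA' c%:A = c%:A by rewrite /= rmorph_alg rmorph_alg.
    by rewrite dc; apply: sp0.
  - by apply: span_over_mem => //; apply: map_f.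
  - by rewrite rmorphD dD; apply: spD.
  - by rewrite rmorphM dM; apply: spD; [apply: (spZ y)|apply: (spZ z)].
have span_all x : span_over S s (d (iA' x)).
  have [u [v [gu gv Uv ->]]] := gP x.
  have du : d (iA' u) = iA' (u / v) *: d (iA' v) + iA' v *: d (iA' (u / v)).
    by rewrite -dM -rmorphM divrK.
  have -> : d (iA' (u / v)) = v^-1 *: ((d (iA' u) : N) - (u / v) *: (d (iA' v) : N)).
    transitivity (iA' v^-1 *: (d (iA' u) - iA' (u / v) *: d (iA' v))); last by [].
    by rewrite du addrC addKr scalerA -rmorphM mulVr // rmorph1 scale1r.
  apply: (spZ); rewrite -scaleNr; apply: (spD); first exact: span_gen.
  by apply: (spZ); apply: span_gen.
apply: (nakayama tau_rad S_sub (s := s)); last exact: span_all.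
(* Writing [x] as [r' t + c] with [c] a scalar gives [dx = r' dt + t dr'], a multiple of [dt] modulo
   [t]. *)
move=> _ /mapP [x _ ->]; have [c cx] := rclr_closed hA x.
have [s' [r [Ns' s'x]]] : exists s' r, ~ pt p0 s' /\ s' * nu (x - c%:A) = r * t p0.
  have [_ _ tgen] := ht p0; have [|s' [r [Ns' E]]] := tgen (nu (x - c%:A)); last by exists s', r.
  exact/(fib_over hpt p0).
have [w ws'] := regular_unit Ns'; have [r' r'E] := nu_surj (w * r).
have xE : iA' x = iA' r' * iB (t p0) + c%:A.
  have -> : iA' x = iA' (x - c%:A) + c%:A by rewrite /= !rmorphB /= !rmorph_alg subrK.
  by congr (_ + _); rewrite /= -[nu (x - _)]mul1r -ws' -mulrA s'x mulrA r'E rmorphM.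
exists (iA' r' *: dt : M), (d (iA' r')); split=> //; first by exists (nu r').
rewrite xE dD dc addr0 dM; have -> : iB (t p0) = iA' tau by rewrite /= -tauE.
by [].
Qed.

Lemma differentials_rank1 x : exists z, x = z *: dt.
Proof.
apply: (kaehler_span hd (S := fun x => exists z, x = z *: dt)).
  split=> [|_ _ [z ->] [w ->]|a _ [z ->]]; first by exists 0; rewrite scale0r.
    by exists (z + w); rewrite scalerDl.
  by exists (a * z); rewrite scalerA.
move=> z; have [b [c [Uc czb]]] := fraction_denominator z.
have dB b' : exists w, d (iB b') = iB w *: dt.
  by have [a ->] := nu_surj b'; apply: regular_diff_generated.
have [[w wE] [w' w'E]] := (dB b, dB c).
exists ((iB c)^-1 * (iB w - z * iB w')).
have := dM (iB c) z; rewrite czb wE w'E scalerA => E.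
by rewrite -scalerA scalerBl E addrK scalerA mulVr ?scale1r.
Qed.

Lemma dualizing_regular x : omega x -> exists a, x = iA nu iB a *: dt.
Proof.
have [z ->] := differentials_rank1 x.
have [b [c [Uc czb]]] := fraction_denominator z => xo.
have [b0|[m [u [[u' u'u] bE]]]] := regular_order b.
  exists 0; rewrite /iA !rmorph0 -[z](mulKr Uc) czb b0 rmorph0 mulr0.
  by [].
have [c0|[n [v [[v' v'v] cE]]]] := regular_order c.
  by move: Uc; rewrite c0 rmorph0 unitr0.
have zE : iB (t p0) ^+ n * z = iB (v' * u * t p0 ^+ m).
  have tnE : t p0 ^+ n = v' * c by rewrite cE mulrA v'v mul1r.
  by rewrite -rmorphXn tnE -mulrA -bE !rmorphM -mulrA czb.
have Utn j : iB (t p0) ^+ j \is a GRing.unit by rewrite unitrX.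
have [le_nm|lt_mn] := leqP n m.
  have [a aE] := nu_surj (v' * u * t p0 ^+ (m - n)); exists a.
  rewrite /iA -aE -[z](mulKr (Utn n)) zE -{1}(subnK le_nm) exprD mulrA rmorphM rmorphXn.
  by rewrite mulrC mulrK.
(* Here [z] is a unit times a negative power of [t p0]. The function [f] inverts the unit and leaves
   exactly [t p0] in the denominator, so [f z dt] is the simple pole, whose residue 1 contradicts
   duality. *)
have [f fE] := nu_surj (u' * v * t p0 ^+ (n - m).-1).
have := xo f; rewrite (bigD1 p0) //= big1 => [|p]; last by rewrite (regular_fiber p) eqxx.
suff -> : iA nu iB f *: (z *: dt) = simple_pole p0.
  by rewrite residue_simple_pole addr0 => /eqP; rewrite oner_eq0.
rewrite scalerA; congr (_ *: _); rewrite scale1r mul1r expr1.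
apply: (can_inj (mulKr (Utn n))); rewrite mulrCA zE /iA -fE -rmorphM.
have nE : n = ((n - m).-1 + m).+1 by rewrite -addSn prednK ?subn_gt0 // subnK // ltnW.
rewrite {2}nE exprSr mulrK // -rmorphXn; congr (iB _).
have -> : u' * v * t p0 ^+ (n - m).-1 * (v' * u * t p0 ^+ m) =
  (u' * u) * (v' * v) * (t p0 ^+ (n - m).-1 * t p0 ^+ m) by ring.
by rewrite u'u v'v !mul1r -exprD.
Qed.

Lemma regular_gorenstein : gorenstein nu iB d pt t.
Proof.
exists dt.
  move=> f; apply: big1 => p _; apply: residue_regular; exact: regular_at_exact.
move=> x /dualizing_regular [a ->]; exists a; split=> // a' E.
(* The coefficient of [dt] is unique because [phi] recovers its expansion, and the expansion is
   injective here. *)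
have [phi phiP] := expansion_exists p0.
have phiE b : phi (iB b *: dt) = (T p0 b)%:L.
  by rewrite (expansionZ phiP) (expansion_d phiP) taylor_map_t ps_deriv_psX tofrac1 mulr1.
have Taa' : T p0 (nu a - nu a') = 0.
  by apply: tofrac_inj; rewrite rmorphB tofracB tofrac0 -!phiE [in X in X - _]E subrr.
have [u /regular_unit [c cu] ua] := taylor_kernel Taa'.
have [iA_inj _ _] := nrm_fractions hnu; apply: iA_inj; congr (iB _).
by apply/eqP; rewrite -subr_eq0 -[_ - _]mul1r -cu -mulrA ua mulr0.
Qed.
End Regular.
End Curve.

Theorem theorem4p18 (k : closedFieldType) (hchar : [pchar k] =i pred0)
    (A : comUnitAlgType k) (B : comAlgType k) (K : comUnitAlgType k)
    (nu : {lrmorphism A -> B}) (iB : {lrmorphism B -> K})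
    (M : lmodType K) (d : K -> M)
    (P : finType) (pt : P -> B -> Prop) (t : P -> B) (D : P -> nat)
    (hA : reduced_curve_local_ring A)
    (hnu : is_normalization nu iB)
    (hd : is_kaehler d)
    (hpt : is_fiber nu pt)
    (ht : forall p, uniformizer iB pt p (t p))
    (hD : dominates_conductor nu pt t D) :
  ~ gorenstein nu iB d pt t ->
  (0 < delta_deg nu iB d pt t D)%R.
Proof.
move=> not_gorenstein; apply: delta_deg_gt0 => // f cf.
(* A unit [f] in the conductor gives A = B: every [b] is the image of [a / f], where
   [nu a = nu f * b]. *)
apply: contrapT => /negP/negPn Uf; apply: not_gorenstein.
have [p _] := fiber_nonempty hA hnu hpt.
apply: regular_gorenstein p => // b.
have [a aE] := cf b; exists (a / f).
by rewrite rmorphM /= aE mulrC mulrA -rmorphM mulVr // rmorph1 mul1r.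
Qed.
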